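(* Let $X$ be a $q$-homogeneous tree with $q\ge 2$, and let $1\le p<\infty$ and $\alpha,\beta>1$. The operator $\mathcal{K}_\beta^\alpha$, defined by $$\mathcal{K}_\beta^\alpha f(z)=\sum_{x\in X}K_\beta(z,x)f(x)q^{(\alpha-\beta)|x|}q^{-\alpha|x|},\qquad f\in L^p_\alpha\cap L^2_\beta,\ z\in X,$$ extends to a bounded operator from $L^p_\alpha$ to $\mathcal{A}^p_\alpha$ if and only if $$p(\beta-1)>\alpha-1.$$ In particular, the Bergman projector $P_\alpha$ is bounded on $L^p_\alpha$ if and only if $p>1$.
   Context: A $q$-homogeneous tree $X$ ($q\ge 2$ an integer) is an undirected connected cycle-free graph in which every vertex has exactly $q+1$ neighbours; $X$ also denotes its vertex set, $o\in X$ is a fixed origin and $|x|$ is the graph distance of $x$ from $o$. A function $f:X\to\mathbb{C}$ is harmonic if $f(v)=\frac1{q+1}\sum_{u\sim v}f(u)$ for every $v\in X$, where $u\sim v$ means adjacency. For $\alpha>1$, $\mu_\alpha$ is the finite measure on $X$ with density $\mu_\alpha(x)=q^{-\alpha|x|}$ with respect to the counting measure. $L^p_\alpha$ is the space of $f:X\to\mathbb{C}$ with $\|f\|_{L^p_\alpha}^p=\sum_{x\in X}|f(x)|^pq^{-\alpha|x|}<\infty$, and $\mathcal{A}^p_\alpha$ is its closed subspace of harmonic functions. $\mathcal{A}^2_\alpha$ is a reproducing kernel Hilbert space (scalar product $\sum_x f(x)\overline{g(x)}q^{-\alpha|x|}$) and $K_\alpha:X\times X\to\mathbb{R}$ denotes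 its reproducing kernel: $K_\alpha(z,\cdot)\in\mathcal{A}^2_\alpha$ and $\sum_x g(x)K_\alpha(z,x)q^{-\alpha|x|}=g(z)$ for all $g\in\mathcal{A}^2_\alpha$, $z\in X$. $P_\alpha:L^2_\alpha\to\mathcal{A}^2_\alpha$ is the orthogonal projection, given by $P_\alpha f(z)=\sum_{x\in X}K_\alpha(z,x)f(x)q^{-\alpha|x|}$. ''$P_\alpha$ is bounded on $L^p_\alpha$'' means that $P_\alpha$, initially defined on $L^p_\alpha\cap L^2_\alpha$, extends to a bounded operator on $L^p_\alpha$. *)

(* Defs.v *)
From mathcomp Require Import all_boot all_order all_algebra.
From mathcomp Require Import all_classical all_reals all_analysis.
From mathcomp Require Import complex.

Set Implicit Arguments.
Unset Strict Implicit.
Unset Printing Implicit Defensive.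

Import Order.TTheory GRing.Theory Num.Theory.

Local Open Scope classical_set_scope.
Local Open Scope ring_scope.
Local Open Scope complex_scope.

(* In [ht_acyclic], irreflexivity excludes closed simple walks of length 1, and
   those of length 2 are an edge walked back and forth: the bound says that there
   is no simple cycle of length at least 3. *)
Record homogeneous_tree (q : nat) := HomogeneousTree {
  vertex :> choiceType ;
  adj : rel vertex ;
  ht_sym : symmetric adj ;
  ht_irr : irreflexive adj ;
  ht_connected : forall x y : vertex, exists2 s, path adj x s & last x s = y ;
  ht_acyclic : forall s : seq vertex, ucycle adj s -> (size s <= 2)%N ;
  ht_degree : forall v : vertex, ([set u | adj v u] #= `I_(q.+1))%card
}.

Definition walk (q : nat) (X : homogeneous_tree q) (x y : X) (n : nat) : bool :=
  `[< exists s : seq X, [/\ path (@adj q X) x s, last x s = y & size s = n] >].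

Lemma walk_exists (q : nat) (X : homogeneous_tree q) (x y : X) :
  exists n, walk x y n.
Proof.
have [s xs sy] := ht_connected x y.
by exists (size s); apply/asboolP; exists s.
Qed.

Definition gdist (q : nat) (X : homogeneous_tree q) (x y : X) : nat :=
  ex_minn (walk_exists x y).

(* Unordered sums, as positive part minus negative part; the value is meaningful
   on (absolutely) summable families only. *)
Definition rsum (R : realType) (T : choiceType) (f : T -> R) : R :=
  fine (\esum_(x in [set: T]) (Num.max (f x) 0)%:E)
  - fine (\esum_(x in [set: T]) (Num.max (- f x) 0)%:E).

Definition csum (R : realType) (T : choiceType) (f : T -> R[i]) : R[i] :=
  rsum (fun x => complex.Re (f x)) +i* rsum (fun x => complex.Im (f x)).

Section Bergman.
Context {R : realType} {q : nat} {X : homogeneous_tree q} (o : X).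
Implicit Types (f g h : X -> R[i]) (p a b : R).

Definition harmonic_fun f : Prop :=
  forall v : X, f v = (q.+1%:R)^-1 * \sum_(u \in [set u | adj v u]) f u.

Definition weight a (x : X) : R := q%:R `^ (- a * (gdist o x)%:R).

Definition wLp_powsum p a f : \bar R :=
  \esum_(x in [set: X]) (ComplexField.Normc.normc (f x) `^ p * weight a x)%:E.

Definition wLp p a : set (X -> R[i]) := [set f | (wLp_powsum p a f < +oo)%E].

Definition wLp_norm p a f : R := (fine (wLp_powsum p a f)) `^ p^-1.

Definition wAp p a : set (X -> R[i]) := wLp p a `&` harmonic_fun.

Definition wL2_inner a f g : R[i] :=
  csum (fun x => f x * (g x)^* * (weight a x)%:C).

Definition reproducing_kernel a (K : X -> X -> R) : Prop :=
  forall z : X,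
    wAp 2 a (fun x => (K z x)%:C) /\
    forall g, wAp 2 a g ->
      csum (fun x => g x * (K z x)%:C * (weight a x)%:C) = g z.

(* There is exactly one reproducing kernel when 1 < a, since point evaluations are
   bounded on A^2_a and complex conjugation preserves A^2_a; the default value of
   [xget] is then irrelevant. *)
Definition bergman_kernel a : X -> X -> R :=
  xget (fun _ _ => 0) [set K | reproducing_kernel a K].

(* The orthogonal projection of L^2_a onto A^2_a, meaningful for f in L^2_a. *)
Definition bergman_projector a f : X -> R[i] :=
  xget (fun=> 0) [set g | wAp 2 a g /\
    forall h, wAp 2 a h -> wL2_inner a (fun x => f x - g x) h = 0].

(* The operator written K_b^a, with a the exponent of the measure and b that of
   the kernel. *)
Definition bergman_type_op a b f (z : X) : R[i] :=
  csum (fun x => (bergman_kernel b z x)%:C * f x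
     * (q%:R `^ ((a - b) * (gdist o x)%:R))%:C * (weight a x)%:C).

(* S, initially defined on the subset D of L^p_a, extends to a bounded linear
   operator from L^p_a to its subspace Y. *)
Definition extends_bounded p a (D : set (X -> R[i]))
    (S : (X -> R[i]) -> (X -> R[i])) (Y : set (X -> R[i])) : Prop :=
  exists T : (X -> R[i]) -> (X -> R[i]),
    [/\ (forall f, wLp p a f -> Y (T f)),
        (forall (c : R[i]) f g, wLp p a f -> wLp p a g ->
           T (fun x => c * f x + g x) = (fun x => c * T f x + T g x)),
        (exists M : R, forall f, wLp p a f ->
           wLp_norm p a (T f) <= M * wLp_norm p a f) &
        (forall f, D f -> T f = S f)].

End Bergman.

(* Main.v *)
Require Import Defs.
From mathcomp Require Import all_boot all_order all_algebra.
From mathcomp Require Import all_classical all_reals all_analysis.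
From mathcomp Require Import complex.
From mathcomp Require Import ring lra zify.
Local Open Scope classical_set_scope.
Local Open Scope ring_scope.

(** Root the tree at [o].  If [f] is harmonic, the increments [f u - f (parent u)]
    behave as a flow: over the children [u] of a vertex [v] they add up to the
    increment at [v] ([harmonic_flowP]).  A harmonic function is therefore made of
    a constant and of independent pieces, one for each vertex [v]: functions that
    live strictly below [v] and equal [c_u (1 + q^-1 + ... + q^(1-n))] at depth
    [n] below [v] in the sector of the child [u], where the [c_u] add up to zero.
    The pieces are orthogonal for every radial weight, so the reproducing kernel
    [K_b] is the sum of their kernels.  Besides the constants, only the pieces at common
    strict ancestors of both arguments contribute; this is [tree_kernel], and
    [kernel_reproducing] checks the reproducing property by summing level by
    level inside the sectors and telescoping along the path from [o] to [z].

    The formula gives the bound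
    [|K_b(z,x)| <= c * sum q^(b|v|)], the sum being over the common ancestors [v]
    of [z] and [x] ([norm_kernel_le]).  The operator is thus dominated by averaging
    [|f|] over the descendants of [v] with weights [q^(-b(|x|-|v|))], followed by
    summation over the ancestors [v] of [z].  Splitting these weights as in
    Schur's test, with Jensen's inequality and the interchange of three sums,
    bounds it on [L^p_a] as soon as some [t > 1] satisfies [p b - (p-1) t > a]
    ([schur_bound], [schur_exponents]); such a [t] exists exactly when
    [a - 1 < p (b - 1)].  The same domination makes the defining series converge
    absolutely for every [f] in [L^p_a], so the operator itself is the extension.

    Conversely, [K_b(o,.)] is a positive constant.  For [p > 1] and
    [p (b - 1) <= a - 1], the radial functions [q^((b-1)|x|)] truncated at
    distance [n] have image at least of order [n] at [o], whereas their norm is at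
    most of order [n^(1/p)].  For [p = 1] and [b <= a], the image of the indicator
    of one vertex at distance [n] already has, summed over the path from [o] to
    that vertex, a norm of order at least [n] times that of the indicator, since the
    kernel is positive along the path ([kernel_anc_ge]).

    On [L^2_a] the operator with [b = a] is the orthogonal projection: it maps
    [L^2_a] to [A^2_a] by the case [p = 2], and it is self-adjoint by Fubini's
    theorem and the symmetry of the kernel.  The second equivalence is then the
    first one for [b = a]. *)

Set Implicit Arguments.
Unset Strict Implicit.
Unset Printing Implicit Defensive.

Import Order.TTheory GRing.Theory Num.Theory.

(** * Unordered sums of real families *)

Section Nsum.
Context {R : realType}.

Definition nsum (T : choiceType) (f : T -> R) : \bar R :=
  \esum_(x in [set: T]) (f x)%:E.

(** One inequality holds for any factor; applied to [c^-1] it gives the other. *)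
Lemma esumZl (T : choiceType) (c : R) (a : T -> \bar R) :
  0 <= c -> (forall x, (0 <= a x)%E) ->
  (\esum_(x in [set: T]) (c%:E * a x) = c%:E * \esum_(x in [set: T]) a x)%E.
Proof.
move=> c0 a0.
have H (d : R) (b : T -> \bar R) : 0 <= d -> (forall x, (0 <= b x)%E) ->
    (\esum_(x in [set: T]) (d%:E * b x) <= d%:E * \esum_(x in [set: T]) b x)%E.
  move=> d0 b0; apply: ge_ereal_sup => _ [A [finA _] <-].
  rewrite -ge0_mule_fsumr//.
  apply: lee_wpmul2l; first by rewrite lee_fin.
  by apply: ereal_sup_ubound; exists A.
apply/eqP; rewrite eq_le H//=.
have [->|cn0] := eqVneq c 0.
  by rewrite mul0e; apply: esum_ge0 => x _; rewrite mul0e.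
have cp : 0 < c by rewrite lt_neqAle eq_sym cn0.
have := H c^-1 (fun x => c%:E * a x)%E.
rewrite invr_ge0 => /(_ c0) H1.
have {}H1 := H1 (fun x => mule_ge0 (c0 : (0 <= c%:E)%E) (a0 x)).
have /eq_esum E : forall x, [set: T] x -> (c^-1%:E * (c%:E * a x) = a x)%E.
  by move=> x _; rewrite muleA -EFinM mulVf// mul1e.
rewrite E in H1.
have := lee_wpmul2l (c0 : (0 <= c%:E)%E) H1.
by rewrite muleA -EFinM mulfV// mul1e.
Qed.

Lemma esum_swap (T1 T2 : choiceType) (a : T1 -> T2 -> \bar R) :
  (forall x y, (0 <= a x y)%E) ->
  (\esum_(x in [set: T1]) \esum_(y in [set: T2]) a x y =
   \esum_(y in [set: T2]) \esum_(x in [set: T1]) a x y)%E.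
Proof.
move=> a0; rewrite !esum_esum//.
rewrite (@reindex_esum R _ _ ([set: T2] `*`` (fun _ => [set: T1])) _ (fun k => (k.2, k.1)))//.
split => //= [[x1 y1] [x2 y2] _ _ [-> ->]//|[x y] _ /=].
by exists (y, x).
Qed.

Lemma nsum_ge0 (T : choiceType) (f : T -> R) : (forall x, 0 <= f x) -> (0 <= nsum f)%E.
Proof. by move=> f0; apply: esum_ge0 => x _; rewrite lee_fin. Qed.

Lemma le_nsum (T : choiceType) (f g : T -> R) :
  (forall x, f x <= g x) -> (nsum f <= nsum g)%E.
Proof. by move=> fg; apply: le_esum => x _; rewrite lee_fin. Qed.

Lemma nsumD (T : choiceType) (f g : T -> R) :
  (forall x, 0 <= f x) -> (forall x, 0 <= g x) ->
  nsum (fun x => f x + g x) = (nsum f + nsum g)%E.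
Proof. by move=> f0 g0; rewrite /nsum -esumD// => x _; rewrite lee_fin. Qed.

Lemma nsumZ (T : choiceType) (c : R) (f : T -> R) :
  0 <= c -> (forall x, 0 <= f x) ->
  nsum (fun x => c * f x) = (c%:E * nsum f)%E.
Proof. by move=> c0 f0; rewrite /nsum -esumZl// => x; rewrite lee_fin. Qed.

Lemma nsumZ_le (T : choiceType) (c B : R) (f : T -> R) :
  0 <= c -> (forall x, 0 <= f x) -> (nsum f <= B%:E)%E ->
  (nsum (fun x => c * f x)%R <= (c * B)%:E)%E.
Proof. by move=> c0 f0 fB; rewrite nsumZ// EFinM lee_wpmul2l. Qed.

Lemma nsum_swap (T1 T2 : choiceType) (a : T1 -> T2 -> R) :
  (forall x y, 0 <= a x y) ->
  (\esum_(x in [set: T1]) nsum (a x) =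
   \esum_(y in [set: T2]) nsum (a^~ y))%E.
Proof. by move=> a0; rewrite /nsum esum_swap// => x y; rewrite lee_fin. Qed.

Lemma nsum_ge (T : choiceType) (f : T -> R) x :
  (forall x, 0 <= f x) -> ((f x)%:E <= nsum f)%E.
Proof.
move=> f0; apply: esum_ge; exists [set x]; first by split.
by rewrite fsbig_set1.
Qed.

Lemma nsum_seq (T : choiceType) (s : seq T) (f : T -> R) :
  uniq s -> (forall x, 0 <= f x) ->
  nsum (fun x => (x \in s)%:R * f x) = (\sum_(x <- s) f x)%:E.
Proof.
move=> us f0; rewrite /nsum.
transitivity (\esum_(x in [set` s]) (f x)%:E)%E.
  rewrite [RHS]esum_mkcond; apply: eq_esum => x _.
  rewrite (_ : (x \in [set` s]) = (x \in s)); last by apply/idP/idP; rewrite inE.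
  by case: (x \in s); rewrite ?mul1r ?mul0r.
rewrite esum_fset//; last by move=> x _; rewrite lee_fin.
by rewrite -fsbig_seq// sumEFin.
Qed.

Lemma nsum_fin_num (T : choiceType) (f : T -> R) :
  (forall x, 0 <= f x) -> (nsum f < +oo)%E -> nsum f = (fine (nsum f))%:E.
Proof. by move=> f0 foo; rewrite fineK// ge0_fin_numE// nsum_ge0. Qed.

Definition rsummable (T : choiceType) (f : T -> R) := (nsum (fun x => `|f x|)%R < +oo)%E.

Lemma rsummable_le (T : choiceType) (f g : T -> R) :
  (forall x, `|f x| <= `|g x|) -> rsummable g -> rsummable f.
Proof. by move=> fg; apply: le_lt_trans; apply: le_nsum. Qed.

Lemma rsummableD (T : choiceType) (f g : T -> R) :
  rsummable f -> rsummable g -> rsummable (fun x => f x + g x).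
Proof.
rewrite /rsummable => fs gs; have := lte_add_pinfty fs gs.
rewrite -nsumD//; apply: le_lt_trans; apply: le_nsum => x; exact: ler_normD.
Qed.

Lemma rsummableZ (T : choiceType) (c : R) (f : T -> R) :
  rsummable f -> rsummable (fun x => c * f x).
Proof.
rewrite /rsummable => fs.
have -> : (fun x => `|c * f x|) = (fun x => `|c| * `|f x|) by apply/funext => x; rewrite normrM.
by rewrite nsumZ// nsum_fin_num// -EFinM ltry.
Qed.

Lemma rsummableN (T : choiceType) (f : T -> R) :
  rsummable f -> rsummable (fun x => - f x).
Proof. by apply: rsummable_le => x; rewrite normrN. Qed.

Lemma rsummable_sum (T : choiceType) (I : Type) (s : seq I) (F : I -> T -> R) :
  (forall i, rsummable (F i)) -> rsummable (fun x => \sum_(i <- s) F i x).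
Proof.
move=> Fs; elim: s => [|i s IH].
  have /funext -> : (fun x => \sum_(i <- [::]) F i x) =1 (fun x => 0 * (0:R)).
    by move=> x; rewrite big_nil mul0r.
  by rewrite /rsummable/nsum esum1// => x _; rewrite mul0r normr0.
have /funext -> : (fun x => \sum_(j <- i :: s) F j x) =1
    (fun x => F i x + \sum_(j <- s) F j x) by move=> x; rewrite big_cons.
exact: rsummableD.
Qed.

Lemma rsummable_nneg (T : choiceType) (f : T -> R) :
  (forall x, 0 <= f x) -> rsummable f = (nsum f < +oo)%E.
Proof.
by move=> f0; rewrite /rsummable; congr (nsum _ < _)%E; apply/funext => x; rewrite ger0_norm.
Qed.

Definition ppart (T : Type) (f : T -> R) x := Num.max (f x) 0.
Definition npart (T : Type) (f : T -> R) x := Num.max (- f x) 0.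

Lemma ppart_ge0 (T : Type) (f : T -> R) x : 0 <= ppart f x.
Proof. by rewrite /ppart le_max lexx orbT. Qed.
Lemma npart_ge0 (T : Type) (f : T -> R) x : 0 <= npart f x.
Proof. by rewrite /npart le_max lexx orbT. Qed.
Lemma posneg_part (T : Type) (f : T -> R) x : f x = ppart f x - npart f x.
Proof. by rewrite /ppart /npart; case: (ltrP (f x) 0); case: (ltrP (- f x) 0); lra. Qed.
Lemma norm_part (T : Type) (f : T -> R) x : `|f x| = ppart f x + npart f x.
Proof.
rewrite /ppart /npart; case: (ltrP (f x) 0) => h; case: (ltrP (- f x) 0) => h'; 
 rewrite ?(ltr0_norm h) ?(ger0_norm h); lra.
Qed.

Lemma ppart_summable (T : choiceType) (f : T -> R) : rsummable f -> (nsum (ppart f) < +oo)%E.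
Proof.
apply: le_lt_trans; apply: le_nsum => x.
by rewrite norm_part lerDl npart_ge0.
Qed.

Lemma npart_summable (T : choiceType) (f : T -> R) : rsummable f -> (nsum (npart f) < +oo)%E.
Proof.
apply: le_lt_trans; apply: le_nsum => x.
by rewrite norm_part lerDr ppart_ge0.
Qed.

Lemma rsumE (T : choiceType) (f : T -> R) :
  rsum f = fine (nsum (ppart f)) - fine (nsum (npart f)).
Proof. by []. Qed.

Lemma nsum_fineD (T : choiceType) (f g : T -> R) :
  (forall x, 0 <= f x) -> (forall x, 0 <= g x) ->
  (nsum f < +oo)%E -> (nsum g < +oo)%E ->
  fine (nsum (fun x => f x + g x)) = fine (nsum f) + fine (nsum g).
Proof.
move=> f0 g0 fo go; rewrite nsumD// (nsum_fin_num f0 fo) (nsum_fin_num g0 go).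
by [].
Qed.

(** Every algebraic rule for [rsum] reduces to this one: a signed sum may be
    computed from any decomposition into nonnegative summable families, not only
    from the positive and negative parts. *)
Lemma rsumB_nneg (T : choiceType) (f g h : T -> R) :
  (forall x, 0 <= g x) -> (forall x, 0 <= h x) ->
  (nsum g < +oo)%E -> (nsum h < +oo)%E ->
  (forall x, f x = g x - h x) ->
  rsum f = fine (nsum g) - fine (nsum h).
Proof.
move=> g0 h0 go ho fE.
have fs : rsummable f.
  have -> : f = (fun x => g x + - h x) by apply/funext.
  by apply: rsummableD; [|apply: rsummableN]; rewrite rsummable_nneg.
have po := ppart_summable fs; have no := npart_summable fs.
rewrite rsumE; apply/eqP; rewrite subr_eq addrAC eq_sym subr_eq; apply/eqP.
rewrite -(nsum_fineD (ppart_ge0 f) h0 po ho) -(nsum_fineD g0 (npart_ge0 f) go no).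
congr (fine (nsum _)); apply/funext => x.
have := posneg_part f x; rewrite fE; lra.
Qed.

Lemma rsum_nneg (T : choiceType) (f : T -> R) : (forall x, 0 <= f x) ->
  (nsum f < +oo)%E -> rsum f = fine (nsum f).
Proof.
move=> f0 fo; have z : nsum (fun _ : T => 0 : R) = 0%E by rewrite /nsum esum1.
rewrite (@rsumB_nneg _ f f (fun=> 0))// ?z//= ?subr0//.
by move=> x; rewrite subr0.
Qed.

Lemma rsumD (T : choiceType) (f g : T -> R) : rsummable f -> rsummable g ->
  rsum (fun x => f x + g x) = rsum f + rsum g.
Proof.
move=> fs gs.
have fp := ppart_summable fs; have fn := npart_summable fs.
have gp := ppart_summable gs; have gn := npart_summable gs.
rewrite (@rsumB_nneg _ _ (fun x => ppart f x + ppart g x) (fun x => npart f x + npart g x)).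
- rewrite !rsumE (nsum_fineD (ppart_ge0 f) (ppart_ge0 g) fp gp).
  by rewrite (nsum_fineD (npart_ge0 f) (npart_ge0 g) fn gn) opprD addrACA.
- by move=> x; rewrite addr_ge0// ppart_ge0.
- by move=> x; rewrite addr_ge0// npart_ge0.
- by rewrite nsumD ?lte_add_pinfty//; exact: ppart_ge0.
- by rewrite nsumD ?lte_add_pinfty//; exact: npart_ge0.
- by move=> x; rewrite (posneg_part f) (posneg_part g); ring.
Qed.

Lemma rsumN (T : choiceType) (f : T -> R) : rsum (fun x => - f x) = - rsum f.
Proof.
rewrite !rsumE opprB; congr (fine _ - fine _).
by congr nsum; apply/funext => x; rewrite /ppart /npart opprK.
Qed.

Lemma rsumZ (T : choiceType) (c : R) (f : T -> R) : rsummable f ->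
  rsum (fun x => c * f x) = c * rsum f.
Proof.
move=> fs.
wlog c0 : c / 0 <= c => [H|].
  have [/H//|c0] := leP 0 c.
  have := H (- c); rewrite oppr_ge0 (ltW c0) => /(_ isT).
  rewrite mulNr => E; apply: oppr_inj; rewrite -E -rsumN.
  by congr rsum; apply/funext => x; rewrite mulNr.
have fp := ppart_summable fs; have fn := npart_summable fs.
have H (g : T -> R) : (forall x, 0 <= g x) -> (nsum g < +oo)%E ->
    nsum (fun x => c * g x) = (c * fine (nsum g))%:E.
  by move=> g0 go; rewrite nsumZ// nsum_fin_num.
rewrite (@rsumB_nneg _ _ (fun x => c * ppart f x) (fun x => c * npart f x)).
- by rewrite !H//=; [rewrite -mulrBr|exact: npart_ge0|exact: ppart_ge0].
- by move=> x; rewrite mulr_ge0// ppart_ge0.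
- by move=> x; rewrite mulr_ge0// npart_ge0.
- by rewrite H ?ltry//; exact: ppart_ge0.
- by rewrite H ?ltry//; exact: npart_ge0.
- by move=> x; rewrite (posneg_part f) mulrBr.
Qed.

Lemma rsumB (T : choiceType) (f g : T -> R) : rsummable f -> rsummable g ->
  rsum (fun x => f x - g x) = rsum f - rsum g.
Proof. by move=> fs gs; rewrite rsumD ?rsumN//; exact: rsummableN. Qed.

Lemma rsum0 (T : choiceType) : rsum (fun _ : T => 0 : R) = 0.
Proof. by rewrite rsumE /ppart /npart oppr0 subrr. Qed.

Lemma rsum_sum (T : choiceType) (I : Type) (s : seq I) (F : I -> T -> R) :
  (forall i, rsummable (F i)) ->
  rsum (fun x => \sum_(i <- s) F i x) = \sum_(i <- s) rsum (F i).
Proof.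
move=> Fs; elim: s => [|i s IH].
  by rewrite big_nil -[RHS](rsum0 T); congr rsum; apply/funext => x; rewrite big_nil.
rewrite big_cons -IH -rsumD//; last exact: rsummable_sum.
by congr rsum; apply/funext => x; rewrite big_cons.
Qed.

Lemma ler_norm_rsum (T : choiceType) (f : T -> R) : rsummable f ->
  `|rsum f| <= fine (nsum (fun x => `|f x|)).
Proof.
move=> fs; have fp := ppart_summable fs; have fn := npart_summable fs.
have -> : (fun x => `|f x|) = (fun x => ppart f x + npart f x).
  by apply/funext => x; rewrite norm_part.
rewrite (nsum_fineD (ppart_ge0 f) (npart_ge0 f) fp fn).
rewrite rsumE (le_trans (ler_normB _ _))//.
by rewrite !ger0_norm// fine_ge0// nsum_ge0//; [exact: npart_ge0|exact: ppart_ge0].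
Qed.

Lemma rsummable_section (T1 T2 : choiceType) (F : T1 -> T2 -> R) :
  (\esum_(x in [set: T1]) nsum (fun y => `|F x y|)%R < +oo)%E ->
  forall x, rsummable (F x).
Proof.
move=> H x; apply: le_lt_trans H; apply: esum_ge; exists [set x]; first by split.
by rewrite fsbig_set1.
Qed.

Lemma nsum_fine (T1 T2 : choiceType) (F : T1 -> T2 -> R) :
  (forall x y, 0 <= F x y) -> (\esum_(x in [set: T1]) nsum (F x) < +oo)%E ->
  nsum (fun x => fine (nsum (F x))) = (\esum_(x in [set: T1]) nsum (F x))%E.
Proof.
move=> F0 H; apply: eq_esum => x _; rewrite -nsum_fin_num//.
have := @rsummable_section _ _ F; rewrite /rsummable.
have -> : (fun x => nsum (fun y => `|F x y|)) = (fun x => nsum (F x)).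
  by apply/funext => z; congr nsum; apply/funext => y; rewrite ger0_norm.
move=> /(_ H x); congr (nsum _ < _)%E.
by apply/funext => y; rewrite ger0_norm.
Qed.

Lemma rsum_fine_nsum (T1 T2 : choiceType) (F : T1 -> T2 -> R) :
  (\esum_(x in [set: T1]) nsum (fun y => `|F x y|)%R < +oo)%E ->
  rsum (fun x => rsum (F x)) =
  fine (\esum_(x in [set: T1]) nsum (ppart (F x))) -
  fine (\esum_(x in [set: T1]) nsum (npart (F x))).
Proof.
move=> H.
have Hp : (\esum_(x in [set: T1]) nsum (ppart (F x)) < +oo)%E.
  apply: le_lt_trans H; apply: le_esum => x _; apply: le_nsum => y.
  by rewrite norm_part lerDl npart_ge0.
have Hn : (\esum_(x in [set: T1]) nsum (npart (F x)) < +oo)%E.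
  apply: le_lt_trans H; apply: le_esum => x _; apply: le_nsum => y.
  by rewrite norm_part lerDr ppart_ge0.
rewrite (@rsumB_nneg _ _ (fun x => fine (nsum (ppart (F x))))
  (fun x => fine (nsum (npart (F x)))))//.
- by rewrite !nsum_fine// => x y; [exact: npart_ge0|exact: ppart_ge0].
- by move=> x; rewrite fine_ge0// nsum_ge0// => y; exact: ppart_ge0.
- by move=> x; rewrite fine_ge0// nsum_ge0// => y; exact: npart_ge0.
- by rewrite nsum_fine// => x y; exact: ppart_ge0.
- by rewrite nsum_fine// => x y; exact: npart_ge0.
Qed.

(** Fubini's theorem for absolutely summable families. *)
Lemma rsum_swap (T1 T2 : choiceType) (F : T1 -> T2 -> R) :
  (\esum_(x in [set: T1]) nsum (fun y => `|F x y|)%R < +oo)%E ->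
  rsum (fun x => rsum (F x)) = rsum (fun y => rsum (F^~ y)).
Proof.
move=> H; rewrite rsum_fine_nsum// rsum_fine_nsum; last by rewrite -nsum_swap.
congr (fine _ - fine _); rewrite -nsum_swap// => x y; [exact: ppart_ge0|exact: npart_ge0].
Qed.

Lemma rsum_seq (T : choiceType) (s : seq T) (f : T -> R) :
  uniq s -> rsum (fun x => (x \in s)%:R * f x) = \sum_(x <- s) f x.
Proof.
move=> us.
rewrite (@rsumB_nneg _ _ (fun x => (x \in s)%:R * ppart f x) (fun x => (x \in s)%:R * npart f x)).
- rewrite !nsum_seq//; [|exact: npart_ge0|exact: ppart_ge0].
  by rewrite /= -sumrB; apply: eq_bigr => x _; rewrite -posneg_part.
- by move=> x; rewrite mulr_ge0// ppart_ge0.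
- by move=> x; rewrite mulr_ge0// npart_ge0.
- by rewrite nsum_seq ?ltry//; exact: ppart_ge0.
- by rewrite nsum_seq ?ltry//; exact: npart_ge0.
- by move=> x; rewrite {1}(posneg_part f) mulrBr.
Qed.

Lemma nsum_pair (T1 T2 : choiceType) (a : T1 -> T2 -> R) : (forall x y, 0 <= a x y) ->
  nsum (fun k : T1 * T2 => a k.1 k.2) = (\esum_(x in [set: T1]) nsum (a x))%E.
Proof.
move=> a0; rewrite /nsum esum_esum; last by move=> x y _ _; rewrite lee_fin.
by congr esum; apply/seteqP; split.
Qed.

End Nsum.

(** * A Jensen inequality for unordered sums *)

Section Jensen.
Context {R : realType} (T : choiceType).
Implicit Types (w phi : T -> R) (p W B m : R).

(** The graph of [y |-> y^p] lies above its tangent at [m].  This is Young's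
    inequality with exponents [p] and [p / (p - 1)], solved for [y]. *)
Lemma powR_tangent_le p (y m : R) : 1 <= p -> 0 <= y -> 0 < m ->
  y <= m `^ (1 - p) * (y `^ p / p + m `^ p * (1 - p^-1)).
Proof.
move=> p1 y0 m0; have p0 : 0 < p by lra.
suff H : y * m `^ (p - 1) <= y `^ p / p + m `^ p * (1 - p^-1).
  have mp : 0 < m `^ (p - 1) by rewrite powR_gt0.
  have -> : m `^ (1 - p) = (m `^ (p - 1))^-1 by rewrite -powRN opprB.
  by rewrite mulrC ler_pdivlMr.
move: p1; rewrite le_eqVlt => /predU1P[<-|p1].
  by rewrite subrr powRr0 mulr1 powRr1// invr1 mulr1 subrr mulr0 addr0.
have q0 : 0 < p / (p - 1) by rewrite divr_gt0// subr_gt0.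
have pn : p != 0 by lra.
have p1n : p - 1 != 0 by lra.
have := @conjugate_powR R y (m `^ (p - 1)) p (p / (p - 1)) y0 (powR_ge0 _ _) p0 q0.
rewrite -powRrM mulrCA divff// mulr1 invf_div.
have -> : (p - 1) / p = 1 - p^-1 by field.
by apply; field.
Qed.

(** The tangent inequality at a free point [m], summed against [w].  Keeping [m]
    free avoids dividing by a mean that may vanish. *)
Lemma jensen_core w phi p W B m : 1 <= p -> 0 < m ->
  (forall x, 0 <= w x) -> (forall x, 0 <= phi x) ->
  (nsum w <= W%:E)%E -> (nsum (fun x => w x * phi x `^ p)%R <= B%:E)%E ->
  B <= W * m `^ p -> (nsum (fun x => w x * phi x)%R <= (W * m)%:E)%E.
Proof.
move=> p1 m0 w0 f0 wW fB BW; have p0 : 0 < p by lra.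
have pi1 : 0 <= 1 - p^-1 by rewrite subr_ge0 invf_le1.
have step : (nsum (fun x => w x * phi x)%R <=
  nsum (fun x => m `^ (1 - p) * (p^-1 * (w x * phi x `^ p) + (m `^ p * (1 - p^-1)) * w x))%R)%E.
  apply: le_nsum => x.
  have := ler_wpM2l (w0 x) (powR_tangent_le p1 (f0 x) m0).
  by move=> /le_trans; apply; rewrite le_eqVlt; apply/orP; left; apply/eqP; ring.
apply: (le_trans step).
have a0 x : 0 <= p^-1 * (w x * phi x `^ p).
  by rewrite mulr_ge0 ?invr_ge0 ?(ltW p0)// mulr_ge0// powR_ge0.
have b0 x : 0 <= (m `^ p * (1 - p^-1)) * w x by rewrite !mulr_ge0// powR_ge0.
rewrite nsumZ ?powR_ge0//; last by move=> x; rewrite addr_ge0.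
rewrite nsumD//.
have h1 : (nsum (fun x => p^-1 * (w x * phi x `^ p))%R <= (p^-1 * B)%:E)%E.
  by apply: nsumZ_le => //; [rewrite invr_ge0 ltW|move=> x; rewrite mulr_ge0// powR_ge0].
have h2 : (nsum (fun x => (m `^ p * (1 - p^-1)) * w x)%R <= ((m `^ p * (1 - p^-1)) * W)%:E)%E.
  by apply: nsumZ_le => //; rewrite mulr_ge0// powR_ge0.
have h3 := leeD h1 h2.
apply: (le_trans (lee_wpmul2l _ h3)); first by rewrite lee_fin powR_ge0.
rewrite -EFinD -EFinM lee_fin.
have -> : W * m = m `^ (1 - p) * (m `^ p * W).
  rewrite mulrA -powRD; last by apply/implyP => _; rewrite gt_eqF.
  by rewrite subrK powRr1 ?ltW// mulrC.
apply: ler_wpM2l; first exact: powR_ge0.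
have -> : m `^ p * W = p^-1 * (W * m `^ p) + m `^ p * (1 - p^-1) * W by ring.
by rewrite lerD2r; apply: ler_wpM2l => //; rewrite invr_ge0 ltW.
Qed.

Lemma jensen w phi p W : 1 <= p -> 0 < W ->
  (forall x, 0 <= w x) -> (forall x, 0 <= phi x) ->
  (nsum w <= W%:E)%E -> (nsum (fun x => w x * phi x `^ p)%R < +oo)%E ->
  (nsum (fun x => w x * phi x)%R < +oo)%E /\
  ((fine (nsum (fun x => w x * phi x)%R) `^ p)%:E <=
    (W `^ (p - 1))%:E * nsum (fun x => w x * phi x `^ p)%R)%E.
Proof.
move=> p1 W0 w0 f0 wW foo; have p0 : 0 < p by lra.
have wf0 x : 0 <= w x * phi x by rewrite mulr_ge0.
have wfp0 x : 0 <= w x * phi x `^ p by rewrite mulr_ge0// powR_ge0.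
rewrite (nsum_fin_num wfp0 foo).
set B := fine (nsum (fun x => w x * phi x `^ p)).
have B0 : 0 <= B by rewrite fine_ge0// nsum_ge0.
have fB : (nsum (fun x => w x * phi x `^ p)%R <= B%:E)%E.
  by rewrite (nsum_fin_num wfp0 foo).
have core m (m0 : 0 < m) := @jensen_core w phi p W B m p1 m0 w0 f0 wW fB.
move: B0; rewrite le_eqVlt => /predU1P[B0|B0].
  have z (m : R) : 0 < m -> (nsum (fun x => w x * phi x)%R <= m%:E)%E.
    move=> m0; have m1 : 0 < m / W by rewrite divr_gt0.
    have := core _ m1; rewrite -B0 mulrCA divff ?gt_eqF// mulr1; apply.
    by rewrite mulr_ge0 ?ltW ?powR_gt0.
  have fo : (nsum (fun x => w x * phi x)%R < +oo)%E.
    by apply: (le_lt_trans (z 1 ltr01)); rewrite ltry.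
  split => //; rewrite -B0 mule0 lee_fin.
  suff -> : fine (nsum (fun x => w x * phi x)) = 0 by rewrite powR0// gt_eqF.
  apply/eqP; rewrite eq_le fine_ge0 ?nsum_ge0// andbT.
  apply/ler_addgt0Pr => e e0; rewrite add0r -lee_fin -nsum_fin_num//.
  exact: z.
(* the tangent point is the mean of order [p] of [phi] *)
pose m := (B / W) `^ p^-1.
have BW : 0 < B / W by rewrite divr_gt0.
have m0 : 0 < m by rewrite powR_gt0.
have mp : m `^ p = B / W.
  by rewrite /m -powRrM mulVf ?gt_eqF// powRr1// ltW.
have h : (nsum (fun x => w x * phi x)%R <= (W * m)%:E)%E.
  by apply: core => //; rewrite mp mulrCA divff ?gt_eqF// mulr1.
have fo : (nsum (fun x => w x * phi x)%R < +oo)%E.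
  by apply: (le_lt_trans h); rewrite ltry.
split => //; rewrite lee_fin.
have h2 : fine (nsum (fun x => w x * phi x)) <= W * m.
  by rewrite -lee_fin -nsum_fin_num.
apply: (le_trans (ge0_ler_powR (ltW p0) _ _ h2)).
- by rewrite nnegrE fine_ge0// nsum_ge0.
- by rewrite nnegrE mulr_ge0 ?ltW.
rewrite (powRM _ (ltW W0) (ltW m0)) mp.
have -> : W `^ p = W `^ (p - 1) * W.
  rewrite -{3}(powRr1 (ltW W0)) -powRD ?subrK//.
  by apply/implyP => _; rewrite gt_eqF.
by rewrite -mulrA (mulrCA W) divff ?gt_eqF// mulr1.
Qed.

End Jensen.

(** * Unordered sums of complex families *)

Section Csum.
Local Open Scope complex_scope.
Context {R : realType}.
Local Notation normc := ComplexField.Normc.normc.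

Lemma normc_ge0 (z : R[i]) : 0 <= normc z.
Proof. by case: z => a b; rewrite /= sqrtr_ge0. Qed.

Lemma normRe_le (z : R[i]) : `|complex.Re z| <= normc z.
Proof.
case: z => a b /=; rewrite -(sqrtr_sqr a) ler_wsqrtr// lerDl sqr_ge0//.
Qed.

Lemma normIm_le (z : R[i]) : `|complex.Im z| <= normc z.
Proof.
case: z => a b /=; rewrite -(sqrtr_sqr b) ler_wsqrtr// lerDr sqr_ge0//.
Qed.

Lemma normc_le_ReIm (z : R[i]) : normc z <= `|complex.Re z| + `|complex.Im z|.
Proof.
case: z => a b /=; rewrite -[leRHS]ger0_norm ?addr_ge0//.
rewrite -sqrtr_sqr ler_wsqrtr// sqrrD !real_normK ?num_real//.
by rewrite lerD2r lerDl mulrn_wge0// mulr_ge0.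
Qed.

Lemma normc_real (a : R) : normc a%:C = `|a|.
Proof. by rewrite /= expr0n /= addr0 sqrtr_sqr. Qed.

Lemma normc_conj (z : R[i]) : normc z^* = normc z.
Proof. by case: z => a b /=; rewrite sqrrN. Qed.

Definition csummable (T : choiceType) (f : T -> R[i]) :=
  (nsum (fun x => normc (f x)) < +oo)%E.

Lemma csummable_le (T : choiceType) (f : T -> R[i]) (g : T -> R) :
  (forall x, normc (f x) <= g x) -> (nsum g < +oo)%E -> csummable f.
Proof. by move=> fg; apply: le_lt_trans; apply: le_nsum. Qed.

Lemma csummableRe (T : choiceType) (f : T -> R[i]) :
  csummable f -> rsummable (fun x => complex.Re (f x)).
Proof. apply: le_lt_trans; apply: le_nsum => x; exact: normRe_le. Qed.

Lemma csummableIm (T : choiceType) (f : T -> R[i]) :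
  csummable f -> rsummable (fun x => complex.Im (f x)).
Proof. apply: le_lt_trans; apply: le_nsum => x; exact: normIm_le. Qed.

Lemma csummableD (T : choiceType) (f g : T -> R[i]) :
  csummable f -> csummable g -> csummable (fun x => f x + g x).
Proof.
move=> fs gs; have := lte_add_pinfty fs gs.
rewrite -nsumD; [|by move=> x; exact: normc_ge0|by move=> x; exact: normc_ge0].
by apply: csummable_le => x; exact: le_normcD.
Qed.

Lemma csummableZ (T : choiceType) (c : R[i]) (f : T -> R[i]) :
  csummable f -> csummable (fun x => c * f x).
Proof.
rewrite /csummable => fs.
have -> : (fun x => normc (c * f x)) = (fun x => normc c * normc (f x)).
  by apply/funext => x; rewrite ComplexField.Normc.normcM.
rewrite nsumZ ?normc_ge0//; last by move=> x; exact: normc_ge0.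
by rewrite nsum_fin_num// -?EFinM ?ltry// => x; exact: normc_ge0.
Qed.

Lemma csummable_sum (T : choiceType) (I : Type) (s : seq I) (F : I -> T -> R[i]) :
  (forall i, csummable (F i)) -> csummable (fun x => \sum_(i <- s) F i x).
Proof.
move=> Fs; elim: s => [|i s IH].
  rewrite /csummable /nsum esum1// => x _; by rewrite big_nil ComplexField.Normc.normc0.
have -> : (fun x => \sum_(j <- i :: s) F j x) =
    (fun x => F i x + \sum_(j <- s) F j x) by apply/funext => x; rewrite big_cons.
exact: csummableD.
Qed.

Lemma csumD (T : choiceType) (f g : T -> R[i]) : csummable f -> csummable g ->
  csum (fun x => f x + g x) = csum f + csum g.
Proof.
move=> fs gs; rewrite /csum.
rewrite -[RHS]/((_ + _) +i* (_ + _)).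
rewrite -(rsumD (csummableRe fs) (csummableRe gs)) -(rsumD (csummableIm fs) (csummableIm gs)).
by congr (_ +i* _); congr rsum; apply/funext => x; case: (f x) (g x) => [? ?] [? ?].
Qed.

Lemma csumZ (T : choiceType) (c : R[i]) (f : T -> R[i]) : csummable f ->
  csum (fun x => c * f x) = c * csum f.
Proof.
move=> fs; have fr := csummableRe fs; have fi := csummableIm fs.
case: c => a b; rewrite /csum -[RHS]/((_ - _) +i* (_ + _)).
rewrite -!rsumZ// -rsumB; try exact: rsummableZ.
rewrite -rsumD; try exact: rsummableZ.
by congr (_ +i* _); congr rsum; apply/funext => x; case: (f x).
Qed.

Lemma csum0 (T : choiceType) : csum (fun _ : T => 0 : R[i]) = 0.
Proof. by rewrite /csum /= rsum0. Qed.

Lemma csum_sum (T : choiceType) (I : Type) (s : seq I) (F : I -> T -> R[i]) :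
  (forall i, csummable (F i)) ->
  csum (fun x => \sum_(i <- s) F i x) = \sum_(i <- s) csum (F i).
Proof.
move=> Fs; elim: s => [|i s IH].
  by rewrite big_nil -[RHS](csum0 T); congr csum; apply/funext => x; rewrite big_nil.
rewrite big_cons -IH -csumD//; last exact: csummable_sum.
by congr csum; apply/funext => x; rewrite big_cons.
Qed.

Lemma csum_conj (T : choiceType) (f : T -> R[i]) :
  csum (fun x => (f x)^*) = (csum f)^*.
Proof.
rewrite /csum /= -rsumN.
by congr (_ +i* _); congr rsum; apply/funext => x; case: (f x).
Qed.

Lemma csum_real (T : choiceType) (f : T -> R) :
  csum (fun x => (f x)%:C) = (rsum f)%:C.
Proof. by rewrite /csum /= rsum0. Qed.

(** The factor 2 comes from bounding the real and imaginary parts separately; it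
    only enlarges the constants. *)
Lemma normc_csum_le (T : choiceType) (f : T -> R[i]) : csummable f ->
  normc (csum f) <= 2 * fine (nsum (fun x => normc (f x))).
Proof.
move=> fs; apply: (le_trans (normc_le_ReIm _)); rewrite mulrDl !mul1r /csum /=.
have H (g : T -> R) : (forall x, `|g x| <= normc (f x)) ->
    `|rsum g| <= fine (nsum (fun x => normc (f x))).
  move=> gf; have gs : rsummable g by apply: le_lt_trans fs; apply: le_nsum.
  apply: (le_trans (ler_norm_rsum gs)); rewrite fine_le//.
  - by rewrite ge0_fin_numE// nsum_ge0.
  - by rewrite ge0_fin_numE// nsum_ge0// => x; exact: normc_ge0.
  - exact: le_nsum.
by apply: lerD; apply: H => x; [exact: normRe_le|exact: normIm_le].
Qed.

Lemma csum_swap (T1 T2 : choiceType) (F : T1 -> T2 -> R[i]) :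
  (\esum_(x in [set: T1]) nsum (fun y => normc (F x y)) < +oo)%E ->
  csum (fun x => csum (F x)) = csum (fun y => csum (F^~ y)).
Proof.
move=> H; rewrite /csum /= !(@rsum_swap R T1 T2)//; apply: le_lt_trans H; apply: le_esum => x _;
  apply: le_nsum => y; [exact: normIm_le|exact: normRe_le].
Qed.

End Csum.

(** * The rooted tree: parents, ancestors, descendants *)

Lemma uniq_flatten_map (T : eqType) (s : seq T) (D : T -> seq T) (k : T -> T) :
  uniq s -> (forall u : T, uniq (D u)) -> (forall u x : T, x \in D u -> k x = u) ->
  uniq (flatten [seq D u | u <- s]).
Proof.
move=> us uD kD; elim: s us => //= u s IH /andP[us /IH us'].
rewrite cat_uniq uD us' andbT /=; apply/hasPn => x /flatten_mapP[u' u's xu'].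
apply/negP => /= xu; move: us; rewrite -(kD _ _ xu) (kD _ _ xu').
by rewrite u's.
Qed.

Section Tree.
Local Open Scope nat_scope.
Context {q : nat} {X : homogeneous_tree q} (o : X).
Implicit Types (x y z u v : X).
Local Notation adj := (@adj q X).
Local Notation "d| x |" := (gdist o x) (at level 0, x at level 99, format "d| x |").

Lemma gdist_path x : exists s : seq X, [/\ path adj o s, last o s = x & size s = d|x|].
Proof. by rewrite /gdist; case: ex_minnP => m /asboolP. Qed.

Lemma gdist_le (s : seq X) : path adj o s -> d|last o s| <= size s.
Proof.
move=> ps; rewrite /gdist; case: ex_minnP => m _ -> //.
by apply/asboolP; exists s.
Qed.

Lemma gdist_oo : d|o| = 0.
Proof. by apply/eqP; rewrite -leqn0; apply: (@gdist_le [::]). Qed.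

Lemma gdist_eq0 x : (d|x| == 0) = (x == o).
Proof.
apply/eqP/eqP => [|->]; last exact: gdist_oo.
by have [s [_ <- <-]] := gdist_path x => /size0nil ->.
Qed.

Lemma gdist_adj x y : adj x y -> d|y| <= d|x|.+1.
Proof.
move=> xy; have [s [ps sx <-]] := gdist_path x.
have := @gdist_le (rcons s y); rewrite rcons_path ps sx xy last_rcons size_rcons.
by apply.
Qed.

Lemma geodesic_lt (s : seq X) x v : path adj o s -> last o s = x -> size s = d|x| ->
  v \in o :: s -> v != x -> d|v| < d|x|.
Proof.
move=> ps sx ss vs vx; case/splitPl: vs ps sx ss => p1 p2 p1v.
rewrite cat_path => /andP[pp1 _]; rewrite last_cat p1v size_cat.
case: p2 => [/= vx' | y p2 _ <-]; first by rewrite vx' eqxx in vx.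
by have := gdist_le pp1; rewrite p1v /=; lia.
Qed.

(** Two distinct neighbours of [x] that are not farther from [o] than [x] would
    close a cycle: geodesics from both of them to [o] avoid [x], and joining them
    gives a path from one neighbour to the other outside [x].  It follows that a
    vertex other than [o] has exactly one neighbour that is not a child. *)
Lemma lower_nbr_unique x y y' : adj x y -> adj x y' ->
  d|y| <= d|x| -> d|y'| <= d|x| -> y = y'.
Proof.
move=> xy xy' yx yx'; apply/eqP/negPn/negP => yny'.
have nx t : adj x t -> x != t.
  by move=> xt; apply/eqP => E; move: xt; rewrite -E ht_irr.
have avoid t s : adj x t -> d|t| <= d|x| -> path adj o s -> last o s = t -> size s = d|t| ->
    x \notin o :: s.
  move=> xt tx ps st ss; apply/negP => xs.
  by have := geodesic_lt ps st ss xs (nx _ xt); lia.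
have [s [ps sy ss]] := gdist_path y; have [s' [ps' sy' ss']] := gdist_path y'.
have xs := avoid _ _ xy yx ps sy ss; have xs' := avoid _ _ xy' yx' ps' sy' ss'.
(* from [y] up to [o], then down to [y'] *)
pose w := rev (belast o s) ++ s'.
have ow : last y (rev (belast o s)) = o.
  by rewrite -sy; case: (s) => //= a l; rewrite rev_cons last_rcons.
have pw : path adj y w.
  rewrite cat_path ow ps' andbT -sy rev_path.
  by rewrite (eq_path (e' := adj))// => a b; rewrite /= ht_sym.
have wy' : last y w = y' by rewrite last_cat ow.
have xw : x \notin y :: w.
  rewrite inE negb_or nx//= mem_cat mem_rev negb_or.
  apply/andP; split; last by move: xs'; rewrite inE negb_or => /andP[].
  by apply: contra xs => /mem_belast.
move: wy'; case: (shortenP pw) => p pp up sub py'.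
have cyc : ucycle adj (x :: y :: p).
  apply/andP; split.
    rewrite /= xy rcons_path pp /= py'.
    by rewrite ht_sym.
  rewrite cons_uniq up andbT; apply: contra xw.
  by rewrite !inE => /orP[->//|/sub ->]; rewrite orbT.
have := ht_acyclic cyc => /=.
by case: p py' {pp up sub cyc} => //= E; rewrite E eqxx in yny'.
Qed.

(** With [parent o = o] the increment of a function at [o] is zero, and the
    harmonicity condition takes the same form at [o] as elsewhere. *)
Definition parent x : X :=
  if x == o then o else xget o [set y | adj x y /\ d|y|.+1 = d|x|].

Lemma parent_o : parent o = o.
Proof. by rewrite /parent eqxx. Qed.

Lemma parentP x : x != o -> adj x (parent x) /\ d|parent x|.+1 = d|x|.
Proof.
move=> xo; rewrite /parent (negbTE xo); case: xgetP => [y -> //|].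
have [s [ps sx ss]] := gdist_path x.
case: (lastP s) ps sx ss => [_ /= E|s' y]; first by rewrite E eqxx in xo.
rewrite rcons_path last_rcons size_rcons => /andP[ps' ey] <- ss /(_ (last o s')) [].
split; first by rewrite ht_sym.
have := gdist_le ps'; have := gdist_adj ey; lia.
Qed.

Lemma gdist_parent x : d|parent x| = d|x|.-1.
Proof.
have [->|xo] := eqVneq x o; first by rewrite parent_o gdist_oo.
by have [_ <-] := parentP xo.
Qed.

Lemma adj_lower x y : x != o -> adj x y -> d|y| <= d|x| -> y = parent x.
Proof.
move=> xo xy yx; have [xp pE] := parentP xo.
apply: (lower_nbr_unique xy xp yx); lia.
Qed.

Lemma adj_upper x y : adj x y -> y != parent x \/ x = o -> d|y| = d|x|.+1.
Proof.
move=> xy H; apply/eqP; rewrite eqn_leq gdist_adj//=.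
rewrite ltnNge; apply/negP => yx; case: H => [/eqP|] H.
  have [xo|xo] := eqVneq x o; last by apply: H; exact: adj_lower.
  move: yx xy; rewrite xo gdist_oo leqn0 gdist_eq0 => /eqP ->.
  by rewrite ht_irr.
move: yx xy; rewrite H gdist_oo leqn0 gdist_eq0 => /eqP ->.
by rewrite ht_irr.
Qed.

Lemma finite_nbrs v : finite_set [set u | adj v u].
Proof. by exists q.+1; exact: ht_degree. Qed.

Definition nbrs v : seq X := finmap.enum_fset (fset_set [set u | adj v u]).

Lemma mem_nbrs v u : (u \in nbrs v) = adj v u.
Proof.
rewrite /nbrs in_fset_set; last exact: finite_nbrs.
by apply/idP/idP; rewrite inE.
Qed.

Lemma uniq_nbrs v : uniq (nbrs v).
Proof. exact: finmap.fset_uniq. Qed.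

Lemma size_nbrs v : size (nbrs v) = q.+1.
Proof. exact: (card_fset_set (ht_degree v)). Qed.

Definition children v : seq X := [seq u <- nbrs v | d|u| == d|v|.+1].

Lemma uniq_children v : uniq (children v).
Proof. by rewrite filter_uniq// uniq_nbrs. Qed.

Lemma mem_children v u : (u \in children v) = (u != o) && (parent u == v).
Proof.
rewrite mem_filter mem_nbrs; apply/idP/idP => [/andP[/eqP du vu]|/andP[uo /eqP <-]].
  have uo : u != o by rewrite -gdist_eq0 du.
  rewrite uo eq_sym; apply/eqP; apply: adj_lower => //; first by rewrite ht_sym.
  by rewrite du leqnSn.
have [up <-] := parentP uo.
by rewrite eqxx ht_sym.
Qed.

Lemma perm_nbrs v : perm_eq (nbrs v) (if v == o then children v else parent v :: children v).
Proof.
apply: uniq_perm; first exact: uniq_nbrs.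
  case: eqVneq => vo; first exact: uniq_children.
  rewrite /= uniq_children andbT mem_filter gdist_parent negb_and.
  by apply/orP; left; apply/eqP; lia.
move=> u; rewrite mem_nbrs; case: eqVneq => vo.
  rewrite mem_filter mem_nbrs; apply/idP/andP => [vu|[]//].
  by split => //; apply/eqP; apply: adj_upper => //; right.
rewrite inE mem_filter mem_nbrs.
have [->|up] := eqVneq u (parent v); first by have [-> _] := parentP vo.
apply/idP/andP => [vu|[]//].
by split => //; apply/eqP; apply: adj_upper => //; left.
Qed.

Lemma size_children v : size (children v) = q + (v == o).
Proof.
have := perm_size (perm_nbrs v); rewrite size_nbrs.
by case: eqVneq => /=; lia.
Qed.

(** The vertex at distance [j] from [o] on the path from [o] to [x]; it is [x]
    itself when [j] exceeds the distance of [x]. *)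
Definition anc j x := iter (d|x| - j) parent x.
Definition below v x := anc d|v| x == v.

Lemma iter_parent_eq m n x : m = n -> iter m parent x = iter n parent x.
Proof. by move=> ->. Qed.

Lemma gdist_iter n x : d|iter n parent x| = d|x| - n.
Proof. by elim: n => [|n IH] /=; rewrite ?subn0// gdist_parent IH; lia. Qed.

Lemma gdist_anc j x : j <= d|x| -> d|anc j x| = j.
Proof. by rewrite gdist_iter; lia. Qed.

Lemma anc_self x : anc d|x| x = x.
Proof. by rewrite /anc subnn. Qed.

Lemma anc0 x : anc 0 x = o.
Proof. by apply/eqP; rewrite -gdist_eq0; apply/eqP; apply: gdist_anc. Qed.

Lemma anc_parent j x : j < d|x| -> parent (anc j.+1 x) = anc j x.
Proof. by move=> jx; rewrite /anc -iterS; apply: iter_parent_eq; lia. Qed.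

Lemma anc_anc i j x : i <= j -> j <= d|x| -> anc i (anc j x) = anc i x.
Proof.
move=> ij jx; rewrite {1}/anc gdist_anc// /anc -iterD; apply: iter_parent_eq; lia.
Qed.

Lemma belowE v x : below v x = (anc d|v| x == v).
Proof. by []. Qed.

Lemma below_le v x : below v x -> d|v| <= d|x|.
Proof.
move=> /eqP bv; rewrite leqNgt; apply/negP => xv.
by move: bv (xv); rewrite /anc (_ : d|x| - d|v| = 0) /= => [->|]; lia.
Qed.

Lemma below_anc j x : j <= d|x| -> below (anc j x) x.
Proof. by move=> jx; rewrite /below gdist_anc. Qed.

Lemma below_self x : below x x.
Proof. by rewrite /below anc_self. Qed.

Lemma below_parent u x : u != o -> below u x -> below (parent u) x.
Proof.
move=> uo ux; have le := below_le ux; have [_ pu] := parentP uo.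
rewrite /below; move: (ux) => /eqP {2}<-.
by rewrite -pu anc_parent// pu.
Qed.

Lemma below_gt v x : below v x -> x != v -> d|v| < d|x|.
Proof.
move=> vx xv; rewrite ltn_neqAle below_le// andbT.
by apply: contra xv => /eqP E; move: vx; rewrite /below E anc_self.
Qed.

Lemma below_of_parent v y : d|v| < d|y| -> below v y = below v (parent y).
Proof.
move=> vy; rewrite /below /anc gdist_parent -iterSr.
by congr (_ == _); apply: iter_parent_eq; lia.
Qed.

(** The descendants of [v] exactly [n] generations below [v]. *)
Fixpoint desc v n : seq X :=
  if n is m.+1 then flatten [seq desc u m | u <- children v] else [:: v].

Lemma mem_desc_iter v n x :
  (x \in desc v n) = (iter n parent x == v) && (d|x| == d|v| + n).
Proof.
elim: n v => [|n IH] v /=.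
  by rewrite inE addn0; have [->|] := eqVneq x v; rewrite ?eqxx.
apply/flatten_mapP/andP => [[u]|[/eqP xv /eqP dx]].
  rewrite mem_children IH => /andP[uo /eqP <-] /andP[/eqP -> /eqP ->].
  by split => //; have [_ <-] := parentP uo; apply/eqP; lia.
have du : d|iter n parent x| = d|v|.+1 by rewrite gdist_iter dx; lia.
exists (iter n parent x).
  by rewrite mem_children -gdist_eq0 du/= xv.
by rewrite IH eqxx du dx; apply/eqP; lia.
Qed.

Lemma mem_desc v n x : (x \in desc v n) = below v x && (n == d|x| - d|v|).
Proof.
rewrite mem_desc_iter; apply/andP/andP => [[/eqP xv /eqP dx]|[vx /eqP ->]].
  by split; [rewrite /below /anc -{2}xv; apply/eqP; apply: iter_parent_eq; lia|apply/eqP; lia].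
by split => //; have := below_le vx => ?; apply/eqP; lia.
Qed.

Lemma uniq_desc v n : uniq (desc v n).
Proof.
elim: n v => [//|n IH] v /=.
apply: (@uniq_flatten_map _ _ _ (iter n parent)) => [|u|u x].
- exact: uniq_children.
- exact: IH.
- by rewrite mem_desc_iter => /andP[/eqP].
Qed.

Lemma size_desc_no v n : v != o -> size (desc v n) = q ^ n.
Proof.
elim: n v => [//|n IH] v vo /=.
rewrite size_flatten /shape -map_comp.
have -> : [seq (size \o desc^~ n) i | i <- children v] = [seq q ^ n | i <- children v].
  by apply/eq_in_map => u; rewrite mem_children => /andP[uo _] /=; rewrite IH.
rewrite sumnE big_map big_const_seq count_predT iter_addn_0 size_children (negbTE vo) addn0.
by rewrite expnS mulnC.
Qed.

Lemma size_desc_o n : size (desc o n.+1) = q ^ n * q.+1.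
Proof.
rewrite /= size_flatten /shape -map_comp.
have -> : [seq (size \o desc^~ n) i | i <- children o] = [seq q ^ n | i <- children o].
  by apply/eq_in_map => u; rewrite mem_children => /andP[uo _] /=; rewrite size_desc_no.
rewrite sumnE big_map big_const_seq count_predT iter_addn_0 size_children eqxx.
by rewrite addn1.
Qed.

Lemma size_desc_le v n : 1 < q -> size (desc v n) <= 2 * q ^ n.
Proof.
move=> q1; have [->|vo] := eqVneq v o; last by rewrite size_desc_no// leq_pmull.
case: n => [//|n]; rewrite size_desc_o expnS mulnC mulnA leq_mul2r.
by apply/orP; right; lia.
Qed.

Lemma size_desc_ge n : 1 < q -> q ^ n <= size (desc o n).
Proof.
by move=> q1; case: n => [//|n]; rewrite size_desc_o expnS mulnC leq_mul2l leqnSn orbT.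
Qed.

Definition ancs x : seq X := [seq iter n parent x | n <- iota 0 d|x|.+1].

Lemma uniq_ancs x : uniq (ancs x).
Proof.
rewrite map_inj_in_uniq ?iota_uniq// => m n; rewrite !mem_iota => mx nx E.
have := gdist_iter m x; rewrite E gdist_iter; lia.
Qed.

Lemma mem_ancs v x : (v \in ancs x) = below v x.
Proof.
apply/mapP/idP => [[n]|vx].
  rewrite mem_iota => nx ->; rewrite (_ : iter n parent x = anc (d|x| - n) x).
    by apply: below_anc; lia.
  by rewrite /anc; apply: iter_parent_eq; lia.
exists (d|x| - d|v|); first by rewrite mem_iota; lia.
by rewrite -/(anc _ _); apply/esym/eqP.
Qed.

Lemma below_o x : below o x.
Proof. by rewrite /below gdist_oo anc0. Qed.

End Tree.

(** * Sums along descendants and ancestors *)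

Section Levels.
Context {R : realType} {q : nat} {X : homogeneous_tree q} (o : X).
Local Notation "d| x |" := (gdist o x) (at level 0, x at level 99, format "d| x |").
Local Notation below := (below o).
Local Notation desc := (desc o).

Lemma nsum_below (v : X) (f : X -> R) : (forall x, 0 <= f x) ->
  nsum (fun x => (below v x)%:R * f x) = nsum (fun n => \sum_(x <- desc v n) f x).
Proof.
move=> f0; pose F (x : X) n := (x \in desc v n)%:R * f x.
have F0 x n : 0 <= F x n by rewrite mulr_ge0.
transitivity (\esum_(x in [set: X]) nsum (F x))%E.
  apply: eq_esum => x _.
  have -> : F x = fun n => (n \in [:: (d|x| - d|v|)%N])%:R * ((below v x)%:R * f x).
    by apply/funext => n; rewrite /F mem_desc inE mulrA -natrM mulnb andbC.
  by rewrite nsum_seq ?big_seq1// => _; rewrite mulr_ge0.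
rewrite nsum_swap//; apply: eq_esum => n _.
by rewrite nsum_seq//; exact: uniq_desc.
Qed.

(** Summation level by level: this turns a sum over the infinite sector of [v]
    into a series of finite sums, to which harmonicity applies. *)
Lemma rsum_below (v : X) (f : X -> R) : rsummable f ->
  rsum (fun x => (below v x)%:R * f x) = rsum (fun n => \sum_(x <- desc v n) f x).
Proof.
move=> fs; pose F (x : X) n := (x \in desc v n)%:R * f x.
have E x : F x = fun n => (n \in [:: (d|x| - d|v|)%N])%:R * ((below v x)%:R * f x).
  by apply/funext => n; rewrite /F mem_desc inE mulrA -natrM mulnb andbC.
transitivity (rsum (fun x => rsum (F x))).
  by congr rsum; apply/funext => x; rewrite E rsum_seq ?big_seq1.
rewrite rsum_swap.
  by congr rsum; apply/funext => n; rewrite rsum_seq//; exact: uniq_desc.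
apply: le_lt_trans fs; apply: le_esum => x _; rewrite E.
have -> : (fun n => `|(n \in [:: (d|x| - d|v|)%N])%:R * ((below v x)%:R * f x)|) =
    fun n => (n \in [:: (d|x| - d|v|)%N])%:R * (`|(below v x)%:R * f x|).
  by apply/funext => n; rewrite normrM normr_nat.
rewrite nsum_seq// big_seq1 lee_fin normrM normr_nat.
by case: (below v x); rewrite ?mul1r ?mul0r.
Qed.

Lemma nsum_geometric (t : R) : 0 <= t -> t < 1 ->
  (nsum (fun n => t ^+ n)%R <= (1 - t)^-1%:E)%E.
Proof.
move=> t0 t1; have t1' : 0 < 1 - t by lra.
rewrite /nsum -nneseries_esumT; last by move=> n; rewrite lee_fin exprn_ge0.
apply: lime_le; first by apply: is_cvg_nneseries => n _ _; rewrite lee_fin exprn_ge0.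
apply: nearW => n; rewrite sumEFin lee_fin big_mkord.
rewrite -[leRHS]mul1r ler_pdivlMr// mulrC -[1 - t]opprB mulNr -subrX1 opprB.
by rewrite lerBlDr lerDl exprn_ge0.
Qed.

(** The sector of [v] has at most [2 q^n] vertices at depth [n], the factor 2
    accounting for the extra child of the root. *)
Lemma nsum_descendants (v : X) (r : R) : (1 < q)%N -> 0 <= r -> q%:R * r < 1 ->
  (nsum (fun x => (below v x)%:R * r ^+ (d|x| - d|v|))%R <= (2 * (1 - q%:R * r)^-1)%:E)%E.
Proof.
move=> q1 r0 qr1; rewrite nsum_below; last by move=> x; exact: exprn_ge0.
have qr0 : 0 <= q%:R * r by rewrite mulr_ge0.
apply: (@le_trans _ _ (nsum (fun n => 2 * (q%:R * r) ^+ n)%R)).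
  apply: le_nsum => n.
  rewrite (eq_big_seq (fun=> r ^+ n)); last first.
    by move=> x; rewrite mem_desc => /andP[_ /eqP ->].
  rewrite big_const_seq count_predT iter_addr_0 -[leLHS]mulr_natl exprMn mulrA.
  apply: ler_wpM2r; first exact: exprn_ge0.
  by rewrite -natrX -natrM ler_nat; exact: size_desc_le.
apply: nsumZ_le => //; last exact: nsum_geometric.
by move=> n; exact: exprn_ge0.
Qed.

Lemma nsum_ancestors (x : X) (f : X -> R) : (forall v, 0 <= f v) ->
  nsum (fun v => (below v x)%:R * f v) = (\sum_(0 <= n < d|x|.+1) f (iter n (parent o) x))%:E.
Proof.
move=> f0; have -> : (fun v => (below v x)%:R * f v) = (fun v => (v \in ancs o x)%:R * f v).
  by apply/funext => v; rewrite mem_ancs.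
by rewrite nsum_seq ?uniq_ancs// /ancs big_map /index_iota subn0.
Qed.

Lemma nsum_ancestors_geometric (x : X) (r : R) : 0 <= r -> r < 1 ->
  (nsum (fun v => (below v x)%:R * r ^+ (d|x| - d|v|))%R <= ((1 - r)^-1)%:E)%E.
Proof.
move=> r0 r1; rewrite nsum_ancestors; last by move=> v; exact: exprn_ge0.
apply: le_trans (nsum_geometric r0 r1).
rewrite -nsum_seq ?iota_uniq//; last by move=> n; exact: exprn_ge0.
apply: le_nsum => n; rewrite mem_index_iota gdist_iter /=.
case: ltnP => nx; rewrite ?mul1r ?mul0r ?exprn_ge0//.
by rewrite subKn.
Qed.

End Levels.

(** * Harmonic functions through their increments *)

Section Harmonic.
Context {R : realType} {q : nat} {X : homogeneous_tree q} (o : X).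
Hypothesis q1 : (1 < q)%N.
Local Notation "d| x |" := (gdist o x) (at level 0, x at level 99, format "d| x |").
Local Notation below := (below o).
Local Notation desc := (desc o).
Local Notation children := (children o).
Local Notation parent := (parent o).
Local Notation anc := (anc o).

(** Harmonicity in terms of increments: what enters [v] from its parent leaves
    through its children. *)
Definition flow_harmonic (F : zmodType) (f : X -> F) :=
  forall v, \sum_(u <- children v) (f u - f v) = f v - f (parent v).

Lemma harmonic_flowP (f : X -> R[i]) : harmonic_fun f <-> flow_harmonic f.
Proof.
have E v : \sum_(u \in [set u | adj v u]) f u =
    \sum_(u <- children v) (f u - f v) + (q.+1%:R * f v - (f v - f (parent v))).
  rewrite fsbig_finite/=; last exact: finite_nbrs.
  rewrite (perm_big _ (perm_nbrs o v)) sumrB.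
  have -> : \sum_(u <- children v) f v = (q + (v == o))%:R * f v.
    by rewrite big_const_seq count_predT iter_addr_0 size_children mulr_natl.
  case: eqVneq => [->|vo].
    by rewrite parent_o addn1 subrr subr0 subrK.
  rewrite big_cons /= addn0 -natr1. ring.
have q0 : (q.+1%:R : R[i]) != 0 by rewrite pnatr_eq0.
split=> H v; move: (H v); rewrite E => Hv.
  move/(congr1 (fun z => q.+1%:R * z)): Hv; rewrite mulrA mulfV// mul1r.
  move=> Hv; apply: (addIr (q.+1%:R * f v - (f v - f (parent v)))).
  by rewrite -Hv addrC subrK.
by rewrite Hv addrC subrK mulrA mulVf// mul1r.
Qed.

Lemma flow_ReIm (f : X -> R[i]) :
  flow_harmonic f <->
  flow_harmonic (fun x => complex.Re (f x)) /\ flow_harmonic (fun x => complex.Im (f x)).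
Proof.
have E v : \sum_(u <- children v) (f u - f v) =
  Complex (\sum_(u <- children v) (complex.Re (f u) - complex.Re (f v)))
    (\sum_(u <- children v) (complex.Im (f u) - complex.Im (f v))).
  elim: (children v) => [|u s IH]; first by rewrite !big_nil.
  by rewrite !big_cons IH; case: (f u) (f v) => [? ?] [? ?].
split=> [H|[Hr Hi] v].
  split=> v; move: (H v); rewrite E.
    by move=> /(congr1 (@complex.Re R)) /= ->; case: (f v) (f (parent v)) => [? ?] [? ?].
  by move=> /(congr1 (@complex.Im R)) /= ->; case: (f v) (f (parent v)) => [? ?] [? ?].
by rewrite E Hr Hi; case: (f v) (f (parent v)) => [? ?] [? ?].
Qed.

Lemma flowB (F : zmodType) (f g : X -> F) :
  flow_harmonic f -> flow_harmonic g -> flow_harmonic (fun x => f x - g x).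
Proof.
have ACA (a b c d : F) : (a - b) - (c - d) = (a - c) - (b - d).
  by rewrite [- (c - d)]opprD addrACA -opprD.
move=> Hf Hg v; rewrite (eq_bigr (fun u => (f u - f v) - (g u - g v))) => [|u _].
  by rewrite sumrB Hf Hg ACA.
by rewrite ACA.
Qed.

Lemma flowD (f g : X -> R) :
  flow_harmonic f -> flow_harmonic g -> flow_harmonic (fun x => f x + g x).
Proof.
move=> Hf Hg v; rewrite (eq_bigr (fun u => (f u - f v) + (g u - g v))); last first.
  by move=> u _; ring.
by rewrite big_split /= Hf Hg; ring.
Qed.

Lemma flowZ (c : R) (f : X -> R) : flow_harmonic f -> flow_harmonic (fun x => c * f x).
Proof.
move=> Hf v; rewrite (eq_bigr (fun u => c * (f u - f v))); last first.
  by move=> u _; ring.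
by rewrite -mulr_sumr Hf; ring.
Qed.

Lemma flow_cst (c : R) : flow_harmonic (fun=> c).
Proof. by move=> v; rewrite big1 ?subrr// => u _; rewrite subrr. Qed.

Lemma flow_sum (I : Type) (s : seq I) (F : I -> X -> R) :
  (forall i, flow_harmonic (F i)) -> flow_harmonic (fun x => \sum_(i <- s) F i x).
Proof.
move=> HF; elim: s => [|i s IH].
  by move=> v; rewrite big1 ?big_nil ?subrr// => u _; rewrite !big_nil subrr.
have -> : (fun x => \sum_(j <- i :: s) F j x) =
    (fun x => F i x + \sum_(j <- s) F j x) by apply/funext => x; rewrite big_cons.
exact: flowD.
Qed.

(** A unit increment at a vertex spreads equally over the children, so it is
    divided by [q] at each generation; this is its cumulated effect. *)
Definition geom_sum n : R := \sum_(k < n) (q%:R ^- k).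

Let q0 : (0 : R) < q%:R. Proof. by rewrite ltr0n; lia. Qed.
Let q2 : (2 : R) <= q%:R. Proof. by rewrite ler_nat. Qed.
Let qn0 : (q%:R : R) != 0. Proof. by rewrite gt_eqF. Qed.

Lemma geom_sum0 : geom_sum 0 = 0. Proof. exact: big_ord0. Qed.

Lemma geom_sumS n : geom_sum n.+1 = 1 + geom_sum n / q%:R.
Proof.
rewrite /geom_sum big_ord_recl expr0 invr1 mulr_suml; congr (_ + _).
by apply: eq_bigr => i _; rewrite lift0 exprS invfM mulrC.
Qed.

Lemma geom_sum_diff n : geom_sum n.+1 - geom_sum n = q%:R ^- n.
Proof. by rewrite /geom_sum big_ord_recr /= addrAC subrr add0r. Qed.

Lemma geom_sum_ge0 n : 0 <= geom_sum n.
Proof. by apply: sumr_ge0 => i _; rewrite invr_ge0 exprn_ge0. Qed.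

Lemma geom_sumS_ge1 n : 1 <= geom_sum n.+1.
Proof. by rewrite geom_sumS lerDl divr_ge0// geom_sum_ge0. Qed.

Lemma geom_sum_le2 n : geom_sum n <= 2.
Proof.
elim: n => [|n IH]; first by rewrite geom_sum0.
rewrite geom_sumS -lerBrDl (_ : 2 - 1 = 1) ?ler_pdivrMr ?mul1r//; last by ring.
exact: le_trans IH q2.
Qed.

(** The increments at the vertices of a given depth below [u] add up to the
    increment at [u], at every depth; only this one survives in the level sums. *)
Lemma sector_sum (g : X -> R) (u : X) n : flow_harmonic g -> u != o ->
  \sum_(x <- desc u n) g x =
  q%:R ^+ n * (g (parent u) + geom_sum n.+1 * (g u - g (parent u))).
Proof.
move=> Hg; elim: n u => [|n IH] u uo.
  by rewrite big_seq1 geom_sumS geom_sum0; ring.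
rewrite /= big_flatten big_map /=.
rewrite (eq_big_seq (fun u' => q%:R ^+ n * g u +
    q%:R ^+ n * geom_sum n.+1 * (g u' - g u))); last first.
  move=> u'; rewrite mem_children => /andP[u'o /eqP pu'].
  by rewrite IH// pu'; ring.
rewrite big_split /= -[X in _ + X]mulr_sumr Hg big_const_seq count_predT iter_addr_0.
rewrite size_children (negbTE uo) addn0 -[X in X + _]mulr_natl (geom_sumS n.+1) exprS.
by field.
Qed.

Lemma level_sum (g : X -> R) n : flow_harmonic g ->
  \sum_(x <- desc o n) g x = (size (desc o n))%:R * g o.
Proof.
move=> Hg; case: n => [|n]; first by rewrite big_seq1 mul1r.
rewrite size_desc_o /= big_flatten big_map /=.
rewrite (eq_big_seq (fun u' => q%:R ^+ n * g o +
    q%:R ^+ n * geom_sum n.+1 * (g u' - g o))); last first.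
  move=> u'; rewrite mem_children => /andP[u'o /eqP pu'].
  by rewrite sector_sum// pu'; ring.
rewrite big_split /= -[X in _ + X]mulr_sumr Hg parent_o subrr mulr0 addr0.
rewrite big_const_seq count_predT iter_addr_0 size_children eqxx addn1.
by rewrite -[LHS]mulr_natl natrM natrX; ring.
Qed.

(** The number of children of a vertex at distance [j] from [o], as a real. *)
Definition nchildren j : R := (q + (j == 0)%N)%:R.

Lemma nchildren_gt0 j : 0 < nchildren j. Proof. by rewrite ltr0n; lia. Qed.
Lemma nchildren_inv_le j : (nchildren j)^-1 <= 2^-1.
Proof. by rewrite lef_pV2 ?posrE ?nchildren_gt0// ler_nat; lia. Qed.

(** Harmonic functions supported strictly below [v = parent u]: up to the factor
    depending on depth, the indicator of the sector of [u] minus its average over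
    the sectors of the children of [v].  Their span is the piece of the orthogonal
    decomposition attached to [v]. *)
Definition sector_fun (u x : X) : R :=
  geom_sum (d|x| - d|parent u|) * (below (parent u) x)%:R *
  ((below u x)%:R - (nchildren d|parent u|)^-1).

(** At [v = parent u] the coefficients of the children add up to zero; deeper in a
    sector the function is a constant multiple of [geom_sum] of the depth, whose
    increments are divided by [q] at each step. *)
Lemma flow_sector_fun u : u != o -> flow_harmonic (sector_fun u).
Proof.
move=> uo x; have [_ du] := parentP uo; set v := parent u in du *.
have h0 z : (d|z| <= d|v|)%N -> sector_fun u z = 0.
  by move=> zv; rewrite /sector_fun -/v (_ : (d|z| - d|v|)%N = 0%N) ?geom_sum0 ?mul0r//; lia.
have [->|xv] := eqVneq x v.
  rewrite !h0 ?subrr ?gdist_parent; [|lia|lia].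
  rewrite (eq_big_seq (fun y => (y == u)%:R - (nchildren d|v|)^-1)); last first.
    move=> y; rewrite mem_children => /andP[yo /eqP py].
    have [_] := parentP yo; rewrite py => dy.
    rewrite subr0 /sector_fun -/v -dy subSnn geom_sumS geom_sum0 mul0r addr0 mul1r.
    rewrite -py below_parent ?below_self// mul1r.
    by rewrite belowE -du py dy anc_self.
  rewrite sumrB big_const_seq count_predT iter_addr_0 size_children.
  rewrite -mulr_natl /nchildren gdist_eq0 mulfV; last by rewrite gt_eqF// ltr0n; lia.
  rewrite (bigD1_seq u) ?uniq_children ?mem_children ?uo ?eqxx//=.
  by rewrite big1 ?addr0 ?subrr// => y /negbTE ->.
have chd y : y \in children x -> parent y = x /\ d|y| = d|x|.+1.
  by rewrite mem_children => /andP[yo /eqP <-]; have [_ ->] := parentP yo.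
have [vx|vx] := boolP (below v x); last first.
  have hz z : (d|v| < d|z|)%N -> below v z = false -> sector_fun u z = 0.
    by move=> _ bz; rewrite /sector_fun -/v bz mulr0 mul0r.
  have hx : sector_fun u x = 0 by rewrite /sector_fun -/v (negbTE vx) mulr0 mul0r.
  rewrite hx big_seq big1 => [|y /chd[py dy]].
    have [le|lt] := leqP d|parent x| d|v|; first by rewrite h0// subrr.
    rewrite hz ?subrr// -below_of_parent ?(negbTE vx)//.
    by move: lt; rewrite gdist_parent; lia.
  rewrite subr0; have [le|lt] := leqP d|y| d|v|; first by rewrite h0.
  by rewrite hz// below_of_parent// py (negbTE vx).
have vltx := below_gt vx xv.
have xo : x != o by rewrite -gdist_eq0; lia.
pose c : R := (below u x)%:R - (nchildren d|v|)^-1.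
have hx : sector_fun u x = geom_sum (d|x| - d|v|) * c by rewrite /sector_fun -/v vx mulr1.
rewrite (eq_big_seq (fun y => c * q%:R ^- (d|x| - d|v|))); last first.
  move=> y /chd[py dy]; rewrite hx /sector_fun -/v.
  have -> : below v y = below v x by rewrite below_of_parent ?py//; lia.
  have -> : below u y = below u x by rewrite below_of_parent ?py//; lia.
  rewrite vx mulr1 -/c -mulrBl dy subSn; last by lia.
  by rewrite geom_sum_diff mulrC.
rewrite big_const_seq count_predT iter_addr_0 size_children (negbTE xo) addn0.
have hp : sector_fun u (parent x) = geom_sum (d|x| - d|v|).-1 * c.
  have [E|E] := eqVneq d|x| d|v|.+1.
    by rewrite E subSnn geom_sum0 mul0r h0// (gdist_parent _ x) E.
  have bp w : (d|w| < d|x|)%N -> below w (parent x) = below w x.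
    by move=> wx; rewrite -below_of_parent.
  rewrite /sector_fun -/v bp// bp; last by lia.
  by rewrite vx mulr1 gdist_parent; congr (geom_sum _ * _); lia.
rewrite hx hp -mulrBl.
have : (0 < d|x| - d|v|)%N by lia.
case: (d|x| - d|v|)%N => // n _ /=.
rewrite geom_sum_diff -mulr_natl exprS invfM.
by field; rewrite mulr1 expf_neq0 ?qn0.
Qed.

Lemma norm_sector_fun_le u x : `|sector_fun u x| <= 2 * (below (parent u) x)%:R.
Proof.
rewrite /sector_fun normrM -[leRHS]mulr1; apply: ler_pM => //.
  by rewrite normrM normr_nat ler_wpM2r// ger0_norm ?geom_sum_ge0 ?geom_sum_le2.
have h1 := nchildren_inv_le d|parent u|.
have h2 : 0 <= (nchildren d|parent u|)^-1 by rewrite invr_ge0 ltW ?nchildren_gt0.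
rewrite ler_norml; case: (below u x) => /=; apply/andP; split; lra.
Qed.

End Harmonic.

(** * An explicit reproducing kernel *)

Section Kernel.
Context {R : realType} {q : nat} {X : homogeneous_tree q} (o : X).
Hypothesis q1 : (1 < q)%N.
Context (rho : R).
Hypothesis rho0 : 0 < rho.
Hypothesis qrho : q%:R * rho < 1.
Local Notation "d| x |" := (gdist o x) (at level 0, x at level 99, format "d| x |").
Local Notation below := (below o).
Local Notation desc := (desc o).
Local Notation children := (children o).
Local Notation parent := (parent o).
Local Notation anc := (anc o).
Local Notation flow_harmonic := (flow_harmonic o).
Local Notation geom_sum := (@geom_sum R q).
Local Notation sector_fun := (@sector_fun R q X o).
Local Notation nchildren := (@nchildren R q).

Let q0 : (0 : R) < q%:R. Proof. by rewrite ltr0n; lia. Qed.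
Let qn0 : (q%:R : R) != 0. Proof. by rewrite gt_eqF. Qed.
Let rho_ge0 := ltW rho0.
Let qr0 : 0 <= q%:R * rho. Proof. by rewrite mulr_ge0. Qed.

Let norm_middle_le (a b c : R) : `|b| <= 2 -> `|a * b * c| <= `|2 * (a * c)|.
Proof.
move=> b2; rewrite (_ : a * b * c = b * (a * c)); last by ring.
by rewrite [leLHS]normrM [leRHS]normrM ler_wpM2r// [leRHS]ger0_norm.
Qed.

Definition wt (x : X) : R := rho ^+ d|x|.
(** The squared norm of the constant function 1. *)
Definition mass : R := fine (nsum wt).
(** Up to the factor [rho^|v| / q], the squared norm of a function of the piece
    at [v] is this number times the squared norm of its coefficients [c_u]. *)
Definition increment_mass : R := fine (nsum (fun n => geom_sum n ^+ 2 * (q%:R * rho) ^+ n)).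
Local Notation N := increment_mass.
Local Notation C := mass.

Lemma wt_ge0 x : 0 <= wt x. Proof. exact: exprn_ge0. Qed.
Lemma wt_gt0 x : 0 < wt x. Proof. exact: exprn_gt0. Qed.

Lemma wt_fin : (nsum wt < +oo)%E.
Proof.
have := @nsum_descendants R q X o o rho q1 rho_ge0 qrho.
have -> : (fun x => (below o x)%:R * rho ^+ (d|x| - d|o|)) = wt.
  by apply/funext => x; rewrite below_o mul1r gdist_oo subn0.
by move=> /le_lt_trans; apply; rewrite ltry.
Qed.

Lemma mass_gt0 : 0 < C.
Proof.
have := nsum_ge o wt_ge0; rewrite (nsum_fin_num wt_ge0 wt_fin) lee_fin => /lt_le_trans.
by apply; exact: wt_gt0.
Qed.

Let nterm_ge0 n : 0 <= geom_sum n ^+ 2 * (q%:R * rho) ^+ n.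
Proof. by rewrite mulr_ge0 ?sqr_ge0 ?exprn_ge0. Qed.

Lemma increment_fin : (nsum (fun n => geom_sum n ^+ 2 * (q%:R * rho) ^+ n)%R < +oo)%E.
Proof.
apply: (@le_lt_trans _ _ (nsum (fun n => 4 * (q%:R * rho) ^+ n)%R)).
  apply: le_nsum => n; apply: ler_wpM2r; first exact: exprn_ge0.
  have := @geom_sum_le2 R _ q1 n; have := @geom_sum_ge0 R q n => ? ?.
  rewrite expr2; have -> : (4 : R) = 2 * 2 by ring.
  exact: ler_pM.
apply: le_lt_trans (nsumZ_le _ _ (nsum_geometric qr0 qrho)) _ => //.
  by move=> n; exact: exprn_ge0.
by rewrite ltry.
Qed.

Lemma increment_gt0 : 0 < N.
Proof.
have := nsum_ge 1%N nterm_ge0; rewrite (nsum_fin_num nterm_ge0 increment_fin) lee_fin.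
have a1 : 0 < geom_sum 1 := lt_le_trans ltr01 (geom_sumS_ge1 0).
by move=> /lt_le_trans; apply; apply: mulr_gt0; rewrite exprn_gt0// mulr_gt0.
Qed.

(** The mean value property on every sphere around [o]. *)
Lemma rsum_mean (g : X -> R) : flow_harmonic g -> rsummable (fun x => g x * wt x) ->
  rsum (fun x => g x * wt x) = g o * C.
Proof.
move=> Hg gs.
have lev (f : X -> R) : rsummable (fun x => f x * wt x) -> flow_harmonic f ->
   rsum (fun x => f x * wt x) = rsum (fun n => f o * ((size (desc o n))%:R * rho ^+ n)).
  move=> fs Hf.
  transitivity (rsum (fun x => (below o x)%:R * (f x * wt x))).
    by congr rsum; apply/funext => x; rewrite below_o mul1r.
  rewrite rsum_below//; congr rsum; apply/funext => n.
  rewrite (eq_big_seq (fun x => f x * rho ^+ n)); last first.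
    by move=> x; rewrite mem_desc /wt gdist_oo subn0 => /andP[_ /eqP <-].
  by rewrite -mulr_suml level_sum//; ring.
have s1 : rsummable (fun n => (size (desc o n))%:R * rho ^+ n).
  rewrite rsummable_nneg; last by move=> n; rewrite mulr_ge0 ?exprn_ge0.
  apply: le_lt_trans wt_fin.
  have -> : wt = fun x => (below o x)%:R * wt x.
    by apply/funext => x; rewrite below_o mul1r.
  rewrite (nsum_below o); last exact: wt_ge0.
  apply: le_nsum => n; rewrite (eq_big_seq (fun x => rho ^+ n)).
    by rewrite big_const_seq count_predT iter_addr_0 mulr_natl.
  by move=> x; rewrite mem_desc /wt gdist_oo subn0 => /andP[_ /eqP <-].
rewrite lev// rsumZ//; congr (_ * _).
have -> : C = rsum (fun x => 1 * wt x).
  rewrite /C -rsum_nneg; [|exact: wt_ge0|exact: wt_fin].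
  by congr rsum; apply/funext => x; rewrite mul1r.
rewrite (lev (fun=> 1)); last exact: flow_cst.
  by rewrite rsumZ// mul1r.
apply: rsummable_le (_ : rsummable wt) => [x|]; first by rewrite mul1r.
by rewrite rsummable_nneg ?wt_fin//; exact: wt_ge0.
Qed.

(** The root has [q + 1] children instead of [q], but its increment is zero. *)
Lemma increment_div_nchildren (g : X -> R) v :
  (g v - g (parent v)) / nchildren d|v| = (g v - g (parent v)) / q%:R.
Proof.
rewrite /nchildren gdist_eq0; case: eqVneq => [->|_]; last by rewrite addn0.
by rewrite parent_o subrr !mul0r.
Qed.

(** The coefficient of a harmonic function on the piece at [v = parent u], read in
    the sector of [u].  At each level [sector_sum] applies in all the sectors of
    the children of [v]; the part common to these sectors cancels, and the sum of
    the increments over the children is the increment at [v]. *)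
Lemma rsum_sector_fun (g : X -> R) u :
  flow_harmonic g -> rsummable (fun x => g x * wt x) -> u != o ->
  rsum (fun x => g x * sector_fun u x * wt x) =
  rho ^+ d|parent u| / q%:R * N *
   ((g u - g (parent u)) - (g (parent u) - g (parent (parent u))) / q%:R).
Proof.
move=> Hg gs uo; have [_ du] := parentP uo; set v := parent u in du *.
pose f x := g x * (geom_sum (d|x| - d|v|) * ((below u x)%:R - (nchildren d|v|)^-1)) * wt x.
have fs : rsummable f.
  apply: rsummable_le (rsummableZ 2 gs) => x; apply: norm_middle_le.
  rewrite normrM -[leRHS]mulr1 ger0_norm ?geom_sum_ge0//.
  apply: ler_pM; rewrite ?geom_sum_ge0 ?geom_sum_le2//.
  have h1 := @nchildren_inv_le R q q1 d|v|.
  have h2 : 0 <= (nchildren d|v|)^-1 by rewrite invr_ge0 ltW ?nchildren_gt0.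
  by rewrite ler_norml; case: (below u x) => /=; apply/andP; split; lra.
transitivity (rsum (fun x => (below v x)%:R * f x)).
  congr rsum; apply/funext => x; rewrite /sector_fun /f -/v; ring.
rewrite rsum_below//.
pose c := rho ^+ d|v| / q%:R * ((g u - g v) - (g v - g (parent v)) / q%:R).
transitivity (rsum (fun n => c * (geom_sum n ^+ 2 * (q%:R * rho) ^+ n))); last first.
  rewrite rsumZ; last by rewrite rsummable_nneg ?increment_fin.
  rewrite (rsum_nneg nterm_ge0 increment_fin) -[fine _]/N.
  by rewrite /c mulrAC.
congr rsum; apply/funext => -[|n].
  by rewrite big_seq1 /f subnn geom_sum0; ring.
rewrite /= big_flatten big_map /=.
pose A := q%:R ^+ n * geom_sum n.+1 * rho ^+ (d|v| + n.+1).
rewrite (eq_big_seq (fun u' => A * g v * ((u' == u)%:R - (nchildren d|v|)^-1)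
   + A * geom_sum n.+1 * ((u' == u)%:R * (g u' - g v) - (g u' - g v) / nchildren d|v|))); last first.
  move=> u'; rewrite mem_children => /andP[u'o /eqP pu'].
  have [_ du'] := parentP u'o; rewrite pu' in du'.
  rewrite (eq_big_seq (fun x => (geom_sum n.+1 * ((u' == u)%:R - (nchildren d|v|)^-1) *
      rho ^+ (d|v| + n.+1)) * g x)); last first.
    move=> x; rewrite mem_desc -du' => /andP[bx /eqP nE].
    have := below_le bx; rewrite -du' => le.
    have dx : d|x| = (d|v| + n.+1)%N by move: nE le; clear; lia.
    have bu : below u x = (u' == u) by move: bx; rewrite !belowE -du -du' => /eqP ->.
    by rewrite /f /wt bu dx addKn -mulrA mulrC.
  rewrite -mulr_sumr sector_sum// pu' /A.
  move: (nchildren d|v|)^-1 (rho ^+ (d|v| + n.+1)) (geom_sum n.+1) (_%:R : R) (g v) (g u').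
  by move=> *; ring.
have um : u \in children v by rewrite mem_children uo eqxx.
have pick (F : X -> R) : \sum_(u' <- children v) (u' == u)%:R * F u' = F u.
  rewrite (bigD1_seq u)/= ?uniq_children// eqxx mul1r big1 ?addr0// => y /negbTE ->.
  by rewrite mul0r.
rewrite big_split /= -[X in X + _]mulr_sumr -[X in _ + X]mulr_sumr !sumrB -mulr_suml Hg.
rewrite increment_div_nchildren pick.
have -> : \sum_(u' <- children v) (u' == u)%:R = (1 : R).
  by rewrite -[RHS](pick (fun=> 1)); apply: eq_bigr => y _; rewrite mulr1.
have -> : \sum_(u' <- children v) (nchildren d|v|)^-1 = (1 : R).
  rewrite big_const_seq count_predT iter_addr_0 size_children -mulr_natl.
  by rewrite /nchildren gdist_eq0 mulfV// gt_eqF// ltr0n; move: q1; clear; lia.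
rewrite subrr mulr0 add0r /A /c exprD exprMn [q%:R ^+ n.+1]exprS.
move: (rho ^+ d|v|) (rho ^+ n.+1) (geom_sum n.+1) (g u) (g v) (g (parent v)) => *.
by field.
Qed.

(** The kernel of the constants plus, for each strict ancestor [v] of [z], the
    kernel of the piece at [v].  The term of index [j] belongs to the ancestor of
    [z] at distance [j] from [o], and [anc j.+1 z] is its child in the direction
    of [z]. *)
Definition tree_kernel (z x : X) : R :=
  C^-1 + \sum_(j < d|z|) (q%:R / N * rho ^- j * geom_sum (d|z| - j)) * sector_fun (anc j.+1 z) x.

Let anc_no j z : (j < d|z|)%N -> anc j.+1 z != o.
Proof. by move=> jz; rewrite -(gdist_eq0 o) gdist_anc. Qed.

Lemma kernel_flow z : flow_harmonic (tree_kernel z).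
Proof.
move=> v; apply: flowD; first exact: flow_cst.
by apply: flow_sum => j; apply: flowZ; apply: flow_sector_fun => //; exact: anc_no.
Qed.

(** By [rsum_sector_fun] the terms are increments of [g] along the path from [o]
    to [z], minus corrections from one generation above; since
    [geom_sum n.+1 = 1 + geom_sum n / q], the sum telescopes to [g z - g o], and
    the constant term contributes [g o]. *)
Lemma kernel_reproducing (g : X -> R) z : flow_harmonic g -> rsummable (fun x => g x * wt x) ->
  rsum (fun x => g x * tree_kernel z x * wt x) = g z.
Proof.
move=> Hg gs.
have hs u : rsummable (fun x => g x * sector_fun u x * wt x).
  apply: rsummable_le (rsummableZ 2 gs) => x; apply: norm_middle_le.
  apply: le_trans (norm_sector_fun_le o q1 u x) _.
  by case: (below _ _); rewrite ?mulr1 ?mulr0.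
transitivity (rsum (fun x => C^-1 * (g x * wt x) + \sum_(j < d|z|)
  (q%:R / N * rho ^- j * geom_sum (d|z| - j)) * (g x * sector_fun (anc j.+1 z) x * wt x))).
  congr rsum; apply/funext => x; rewrite /tree_kernel mulrDr mulrDl; congr (_ + _); first by ring.
  by rewrite mulr_sumr mulr_suml; apply: eq_bigr => j _; ring.
rewrite rsumD; [|exact: rsummableZ|by apply: rsummable_sum => j; exact: rsummableZ].
rewrite rsumZ// rsum_mean// mulrCA mulVf ?mulr1; last by rewrite gt_eqF ?mass_gt0.
rewrite rsum_sum; last by move=> j; exact: rsummableZ.
pose F y := g y - g (parent y).
(* the boundary terms of the telescoping sum *)
pose b j := geom_sum (d|z| - j) * F (anc j z) / q%:R.
rewrite (eq_bigr (fun j : 'I_d|z| => (g (anc j.+1 z) + b j.+1) - (g (anc j z) + b j))); last first.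
  move=> [j jz] _ /=; rewrite rsumZ// rsum_sector_fun ?anc_no// anc_parent// gdist_anc ?(ltnW jz)//.
  rewrite -/(F _) (_ : g (anc j.+1 z) - g (anc j z) = F (anc j.+1 z)); last first.
    by rewrite /F anc_parent.
  rewrite /b; have -> : (d|z| - j)%N = (d|z| - j.+1).+1 by lia.
  rewrite geom_sumS.
  have -> : g (anc j.+1 z) = F (anc j.+1 z) + g (anc j z) by rewrite /F anc_parent// subrK.
  by field; rewrite qn0 expf_neq0 ?gt_eqF ?increment_gt0.
rewrite -(big_mkord xpredT (fun j => (g (anc j.+1 z) + b j.+1) - (g (anc j z) + b j))).
rewrite telescope_sumr// /b subnn geom_sum0 subn0 anc0 anc_self /F parent_o subrr.
by ring.
Qed.

(** [geom_sum] vanishes at 0, so that the sum may run beyond the distances of both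
    arguments, where its general term is visibly symmetric. *)
Lemma kernel_sym z x : tree_kernel z x = tree_kernel x z.
Proof.
pose T z x j := q%:R / N * rho ^- j * geom_sum (d|z| - j) * geom_sum (d|x| - j) *
  (anc j x == anc j z)%:R * ((anc j.+1 x == anc j.+1 z)%:R - (nchildren j)^-1).
have E z' x' n : (d|z'| <= n)%N -> tree_kernel z' x' = C^-1 + \sum_(j < n) T z' x' j.
  move=> zn; rewrite /tree_kernel; congr (_ + _).
  rewrite [RHS](bigID (fun j : 'I_n => (j < d|z'|)%N)) /= [X in _ + X]big1 ?addr0; last first.
    move=> j; rewrite -leqNgt -subn_eq0 => /eqP ze.
    by rewrite /T ze geom_sum0; ring.
  rewrite (big_ord_widen_cond n xpredT
    (fun j => (q%:R / N * rho ^- j * geom_sum (d|z'| - j)) * sector_fun (anc j.+1 z') x'))//=.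
  apply: eq_bigr => j jz.
  rewrite /sector_fun anc_parent// !belowE !gdist_anc ?(ltnW jz)// /T.
  ring.
rewrite (E z x (d|z| + d|x|)%N) ?leq_addr// (E x z (d|z| + d|x|)%N) ?leq_addl//.
congr (_ + _); apply: eq_bigr => j _.
by rewrite /T ![anc _ x == _]eq_sym; ring.
Qed.

Definition kernel_bound : R := C^-1 + 4 * (q%:R / N).

Lemma kernel_bound_gt0 : 0 < kernel_bound.
Proof.
by rewrite ltr_wpDr// ?invr_gt0 ?mass_gt0// mulr_ge0// divr_ge0// ltW// increment_gt0.
Qed.

Lemma norm_kernel_le z x :
  `|tree_kernel z x| <= kernel_bound * \sum_(0 <= j < d|z|.+1) rho ^- j * (below (anc j z) x)%:R.
Proof.
have N0 := increment_gt0; have C0 := mass_gt0.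
have r0 j : 0 <= rho ^- j by rewrite invr_ge0 exprn_ge0.
have t0 j : 0 <= rho ^- j * (below (anc j z) x)%:R :> R by rewrite mulr_ge0.
rewrite /kernel_bound mulrDl; apply: (le_trans (ler_normD _ _)); apply: lerD.
  rewrite ger0_norm ?invr_ge0 ?(ltW C0)// ler_peMr ?invr_ge0 ?(ltW C0)//.
  rewrite big_nat_recl// expr0 invr1 mul1r anc0 below_o lerDl.
  by apply: sumr_ge0.
apply: (le_trans (ler_norm_sum _ _ _)).
rewrite big_nat_recr//= mulrDr -[leLHS]addr0; apply: lerD; last first.
  by rewrite !mulr_ge0// invr_ge0 ltW.
rewrite big_mkord mulr_sumr; apply: ler_sum => -[j jz] _ /=.
rewrite normrM ger0_norm; last by rewrite !mulr_ge0 ?geom_sum_ge0// invr_ge0 ltW.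
have := @norm_sector_fun_le R q X o q1 (anc j.+1 z) x; rewrite anc_parent// => hb.
have -> : 4 * (q%:R / N) * (rho ^- j * (below (anc j z) x)%:R) =
  (q%:R / N * rho ^- j * 2) * (2 * (below (anc j z) x)%:R) by ring.
apply: ler_pM => //; first by rewrite !mulr_ge0 ?geom_sum_ge0// invr_ge0 ltW.
by apply: ler_wpM2l (geom_sum_le2 q1 _); rewrite !mulr_ge0// invr_ge0 ltW.
Qed.

Lemma kernel_o x : tree_kernel o x = C^-1.
Proof. by rewrite /tree_kernel gdist_oo big_ord0 addr0. Qed.

(** All the terms are nonnegative, because the path to [anc j.+1 x] is part of the
    path to [x]: at each common strict ancestor both arguments lie in the same
    sector.  The bound is given by the last term. *)
Lemma kernel_anc_ge j x : (j < d|x|)%N ->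
  q%:R / (2 * N) * rho ^- j <= tree_kernel (anc j.+1 x) x.
Proof.
move=> jx; have N0 := increment_gt0; have C0 := mass_gt0.
have r0 i : 0 <= rho ^- i by rewrite invr_ge0 exprn_ge0.
rewrite /tree_kernel gdist_anc// big_ord_recr /= subSnn.
have hE i : (i <= j)%N -> sector_fun (anc i.+1 (anc j.+1 x)) x =
    geom_sum (d|x| - i) * (1 - (nchildren i)^-1).
  move=> ij; have ix : (i < d|x|)%N := leq_ltn_trans ij jx.
  by rewrite anc_anc// /sector_fun anc_parent// !below_anc ?gdist_anc ?(ltnW ix)// mulr1.
have h0 i : (i <= j)%N -> 2^-1 <= geom_sum (d|x| - i) * (1 - (nchildren i)^-1).
  move=> ij; have := @nchildren_inv_le R q q1 i.
  have -> : (d|x| - i)%N = (d|x| - i).-1.+1 by lia.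
  have := @geom_sumS_ge1 R q (d|x| - i).-1; nra.
have c0 i : 0 <= q%:R / N * rho ^- i by rewrite !mulr_ge0// invr_ge0 ltW.
rewrite -[leLHS]add0r addrA; apply: lerD.
  rewrite addr_ge0 ?invr_ge0 ?(ltW C0)//; apply: sumr_ge0 => -[i ij] _ /=.
  rewrite hE; last by rewrite ltnW.
  rewrite mulr_ge0//; first by rewrite mulr_ge0// geom_sum_ge0.
  by apply: le_trans (h0 _ (ltnW ij)); rewrite invr_ge0.
rewrite hE// geom_sumS geom_sum0 mul0r addr0 mulr1.
have -> : q%:R / (2 * N) * rho ^- j = q%:R / N * rho ^- j * 2^-1.
  by rewrite invfM; ring.
exact: ler_wpM2l (h0 _ (leqnn j)).
Qed.

End Kernel.

(** * The weighted norm estimate for the kernel *)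

Section Schur.
Context {R : realType} {q : nat} {X : homogeneous_tree q} (o : X).
Hypothesis q1 : (1 < q)%N.
Local Notation "d| x |" := (gdist o x) (at level 0, x at level 99, format "d| x |").
Local Notation below := (below o).
Local Notation anc := (anc o).
Local Notation parent := (parent o).

Lemma powR_exprn (x p : R) n : 0 <= x -> (x ^+ n) `^ p = (x `^ p) ^+ n.
Proof.
move=> x0; elim: n => [|n IH]; first by rewrite !expr0 powR1.
by rewrite !exprS powRM ?exprn_ge0// IH.
Qed.

Context (rho sigma tau theta p : R).
Hypothesis rho0 : 0 < rho.
Hypothesis qrho : q%:R * rho < 1.
Hypothesis p1 : 1 <= p.
Hypothesis sigma0 : 0 < sigma.
Hypothesis tau0 : 0 < tau.
Hypothesis qtau : q%:R * tau < 1.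
Hypothesis theta0 : 0 < theta.
Hypothesis theta1 : theta < 1.
Let s1 := theta * (theta^-1) `^ p.
Let r1 := tau * (rho / tau) `^ p.
Hypothesis qs1 : q%:R * (s1 * sigma) < 1.
Hypothesis r1s : r1 / sigma < 1.
Context (phi : X -> R).
Hypothesis phi0 : forall x, 0 <= phi x.

Let s10 : 0 < s1. Proof. by rewrite mulr_gt0// powR_gt0// invr_gt0. Qed.
Let r10 : 0 < r1. Proof. by rewrite mulr_gt0// powR_gt0// divr_gt0. Qed.

(** Schur's test with weights depending on depths: the factor
    [rho^(|x|-|v|)] is split as [omega * psi], where [omega] decays both from [v]
    to [x] and from [v] to [z], and [psi] compensates. *)
Let omega z (k : X * X) : R := (below k.2 z)%:R * theta ^+ (d|z| - d|k.2|) *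
  ((below k.2 k.1)%:R * tau ^+ (d|k.1| - d|k.2|)).
Let psi z (k : X * X) : R := phi k.1 * (rho / tau) ^+ (d|k.1| - d|k.2|) *
  theta^-1 ^+ (d|z| - d|k.2|).

Let omega_ge0 z k : 0 <= omega z k.
Proof. by rewrite /omega !mulr_ge0// exprn_ge0// ltW. Qed.
Let psi_ge0 z k : 0 <= psi z k.
Proof.
rewrite /psi !mulr_ge0// exprn_ge0//; first by rewrite divr_ge0// ltW.
by rewrite invr_ge0 ltW.
Qed.

Let W := (1 - theta)^-1 * (2 * (1 - q%:R * tau)^-1).

Let W_gt0 : 0 < W.
Proof. by rewrite !mulr_gt0// invr_gt0 subr_gt0. Qed.

Let omega_mass z : (nsum (omega z) <= W%:E)%E.
Proof.
have -> : nsum (omega z) = (\esum_(x in [set: X]) nsum (fun v => omega z (x, v)))%E.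
  by rewrite -nsum_pair//; congr nsum; apply/funext => -[].
rewrite nsum_swap//.
apply: (@le_trans _ _ (nsum (fun v => ((2 * (1 - q%:R * tau)^-1)) *
    ((below v z)%:R * theta ^+ (d|z| - d|v|)))%R)).
  apply: le_esum => v _; rewrite /omega /= [X in (_ <= X%:E)%E]mulrC.
  apply: nsumZ_le => [|x|].
  - by rewrite mulr_ge0// exprn_ge0// ltW.
  - by rewrite mulr_ge0// exprn_ge0// ltW.
  - by apply: nsum_descendants => //; exact: ltW.
rewrite /W [X in (_ <= X%:E)%E]mulrC; apply: nsumZ_le => [|v|].
- by rewrite mulr_ge0// invr_ge0 subr_ge0 ltW.
- by rewrite mulr_ge0// exprn_ge0// ltW.
- by apply: nsum_ancestors_geometric => //; exact: ltW.
Qed.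

Definition schur_const : R := (2 * (1 - q%:R * (s1 * sigma))^-1) * (1 - r1 / sigma)^-1.

Let total : (nsum (fun x => phi x `^ p * wt o sigma x)%R < +oo)%E ->
  (\esum_(z in [set: X]) nsum (fun k => wt o sigma z * (omega z k * psi z k `^ p))%R <=
   (schur_const)%:E * nsum (fun x => phi x `^ p * wt o sigma x)%R)%E.
Proof.
move=> foo.
pose t z x v : R := phi x `^ p * ((below v x)%:R * r1 ^+ (d|x| - d|v|)) *
   ((below v z)%:R * s1 ^+ (d|z| - d|v|) * sigma ^+ d|z|).
have t0 z x v : 0 <= t z x v.
  by rewrite /t !mulr_ge0 ?powR_ge0 ?exprn_ge0// ltW.
have tE z : (fun k => wt o sigma z * (omega z k * psi z k `^ p)) = fun k => t z k.1 k.2.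
  apply/funext => -[x v]; rewrite /t /psi /omega /=.
  have rt : 0 <= rho / tau by rewrite divr_ge0 ?ltW.
  have ti : 0 <= theta^-1 by rewrite invr_ge0 ltW.
  rewrite !powRM ?mulr_ge0 ?exprn_ge0// !powR_exprn// /r1 /s1 !exprMn /wt.
  move: (phi x `^ p) (_ ^+ d|z|) (theta ^+ _) (tau ^+ _) ((_ `^ _) ^+ _) ((_ `^ _) ^+ _) => *.
  ring.
under eq_esum => z _ do rewrite tE nsum_pair//.
rewrite esum_swap; last by move=> z x; apply: nsum_ge0.
apply: (@le_trans _ _ (nsum (fun x => schur_const * (phi x `^ p * wt o sigma x))%R)); last first.
  rewrite nsumZ// => [|x].
    rewrite /schur_const mulr_ge0 ?invr_ge0 ?subr_ge0 ?(ltW r1s)//.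
    by rewrite mulr_ge0// invr_ge0 subr_ge0 ltW.
  by rewrite mulr_ge0 ?powR_ge0// wt_ge0.
apply: le_esum => x _; rewrite nsum_swap//.
have c1 : 0 <= 2 * (1 - q%:R * (s1 * sigma))^-1.
  by rewrite mulr_ge0// invr_ge0 subr_ge0 ltW.
apply: (@le_trans _ _ (nsum (fun v =>
    (phi x `^ p * wt o sigma x * (2 * (1 - q%:R * (s1 * sigma))^-1)) *
    ((below v x)%:R * (r1 / sigma) ^+ (d|x| - d|v|)))%R)); last first.
  rewrite (_ : schur_const * _ = (phi x `^ p * wt o sigma x * (2 * (1 - q%:R * (s1 * sigma))^-1)) *
     (1 - r1 / sigma)^-1); last by rewrite /schur_const; ring.
  apply: nsumZ_le => [|v|].
  - by rewrite mulr_ge0// mulr_ge0 ?powR_ge0// wt_ge0.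
  - by rewrite mulr_ge0// exprn_ge0// divr_ge0 ?ltW.
  - by apply: nsum_ancestors_geometric => //; rewrite divr_ge0 ?ltW.
apply: le_esum => v _.
have [vx|vx] := boolP (below v x); last first.
  rewrite mul0r mulr0 /nsum esum1// => z _.
  by rewrite /t (negbTE vx) mul0r mulr0 mul0r.
have le := below_le vx.
have -> : t^~ x ^~ v = fun z => (phi x `^ p * r1 ^+ (d|x| - d|v|) * sigma ^+ d|v|) *
    ((below v z)%:R * (s1 * sigma) ^+ (d|z| - d|v|)).
  apply/funext => z; rewrite /t vx mul1r.
  have [vz|vz] := boolP (below v z); last by rewrite !mul0r !mulr0.
  rewrite -{2}(subnK (below_le vz)) exprD [(s1 * sigma) ^+ _]exprMn.
  move: (phi x `^ p) (r1 ^+ _) (s1 ^+ _) (sigma ^+ d|v|) (sigma ^+ _) => *; ring.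
have -> : phi x `^ p * wt o sigma x * (2 * (1 - q%:R * (s1 * sigma))^-1) *
    (1%:R * (r1 / sigma) ^+ (d|x| - d|v|)) =
    (phi x `^ p * r1 ^+ (d|x| - d|v|) * sigma ^+ d|v|) * (2 * (1 - q%:R * (s1 * sigma))^-1).
  rewrite /wt -{1}(subnK le) exprD [(r1 / sigma) ^+ _]exprMn mul1r exprVn.
  have : sigma ^+ (d|x| - d|v|) != 0 by rewrite expf_neq0// gt_eqF.
  move: (phi x `^ p) (r1 ^+ _) (_^-1) (sigma ^+ d|v|) (sigma ^+ _) => *.
  by field.
apply: nsumZ_le => [|z|].
- by rewrite !mulr_ge0 ?powR_ge0 ?exprn_ge0// ltW.
- by rewrite mulr_ge0// exprn_ge0// mulr_ge0 ?ltW.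
- by apply: nsum_descendants => //; rewrite mulr_ge0 ?ltW.
Qed.

Let kernel_le_omega z :
  (nsum (fun x => `|tree_kernel o rho z x| * wt o rho x * phi x)%R <=
   (kernel_bound o rho)%:E * nsum (fun k => omega z k * psi z k)%R)%E.
Proof.
pose g x v : R := (below v z)%:R * ((below v x)%:R * rho ^+ (d|x| - d|v|) * phi x).
have g0 x v : 0 <= g x v by rewrite /g !mulr_ge0// exprn_ge0// ltW.
have -> : (fun k => omega z k * psi z k) = fun k => g k.1 k.2.
  apply/funext => -[x v]; rewrite /omega /psi /g /= exprMn !exprVn.
  have : theta ^+ (d|z| - d|v|) != 0 by rewrite expf_neq0// gt_eqF.
  have : tau ^+ (d|x| - d|v|) != 0 by rewrite expf_neq0// gt_eqF.
  move: (theta ^+ _) (tau ^+ _) (rho ^+ _) => *.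
  by field; apply/andP.
have kb := kernel_bound_gt0 o q1 rho0 qrho.
rewrite nsum_pair// -esumZl ?(ltW kb)//; last by move=> x; exact: nsum_ge0.
apply: le_esum => x _.
have f0 v : 0 <= (below v x)%:R * rho ^+ (d|x| - d|v|) * phi x.
  by rewrite !mulr_ge0// exprn_ge0// ltW.
rewrite /g nsum_ancestors// -EFinM lee_fin.
have := norm_kernel_le o q1 rho0 qrho z x.
move/(ler_wpM2r (wt_ge0 o rho0 x))/(ler_wpM2r (phi0 x)) => /le_trans; apply.
rewrite -!mulrA ler_wpM2l ?(ltW kb)// mulr_suml.
rewrite [leRHS]big_nat_rev /= le_eqVlt; apply/orP; left; apply/eqP.
apply: eq_big_nat => j /andP[_ jz]; rewrite add0n subSS.
have -> : iter (d|z| - j) parent z = anc j z by [].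
rewrite gdist_anc//; have [b|b] := boolP (below _ x); last by rewrite !(mul0r, mulr0).
have := below_le b; rewrite gdist_anc// => jx.
rewrite /wt -{1}(subnK jx) exprD.
have : rho ^+ j != 0 by rewrite expf_neq0// gt_eqF.
move: (rho ^+ j) (rho ^+ _) => *; by field.
Qed.

(** Jensen's inequality is applied, for each [z], to the sum over pairs [(x, v)]
    with [v] a common ancestor of [z] and [x], for the measure [omega z], whose
    mass is bounded by [W].  After interchange of the sums, the sum over [z]
    converges by [qs1] and the sum over [v] by [r1s]. *)
Lemma schur_bound : (nsum (fun x => phi x `^ p * wt o sigma x)%R < +oo)%E ->
  (forall z, (nsum (fun x => `|tree_kernel o rho z x| * wt o rho x * phi x)%R < +oo)%E) /\
  (nsum (fun z => fine (nsum (fun x => `|tree_kernel o rho z x| * wt o rho x * phi x)) `^ p *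
      wt o sigma z)%R
   <= (kernel_bound o rho `^ p * W `^ (p - 1) * schur_const)%:E *
      nsum (fun x => phi x `^ p * wt o sigma x)%R)%E.
Proof.
move=> foo; have tot := total foo.
have p0 : 0 <= p by apply: le_trans p1.
have kb := kernel_bound_gt0 o q1 rho0 qrho.
set B := nsum (fun x => phi x `^ p * wt o sigma x) in foo tot *.
have Bge : (0 <= B)%E.
  by apply: nsum_ge0 => x; rewrite mulr_ge0 ?powR_ge0// wt_ge0.
have op0 z k : 0 <= omega z k * psi z k `^ p by rewrite mulr_ge0// powR_ge0.
have fin z : (nsum (fun k => omega z k * psi z k `^ p)%R < +oo)%E.
  have : (nsum (fun k => wt o sigma z * (omega z k * psi z k `^ p))%R < +oo)%E.
    have h : (schur_const%:E * B < +oo)%E.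
      rewrite /B (nsum_fin_num _ foo) ?ltry// => x.
      by rewrite mulr_ge0 ?powR_ge0// wt_ge0.
    apply: le_lt_trans h; apply: le_trans tot.
    apply: esum_ge; exists [set z]; first by split.
    by rewrite fsbig_set1.
  rewrite nsumZ ?(wt_ge0 o sigma0)// => H; rewrite ltNge leye_eq; apply/negP => /eqP E.
  by move: H; rewrite E mulry gtr0_sg ?(wt_gt0 o sigma0)// mul1e.
have J z := jensen p1 W_gt0 (omega_ge0 z) (psi_ge0 z) (omega_mass z) (fin z).
have kle := kernel_le_omega.
have k0 z x : 0 <= `|tree_kernel o rho z x| * wt o rho x * phi x.
  by rewrite !mulr_ge0// wt_ge0.
have opz0 z k : 0 <= omega z k * psi z k by rewrite mulr_ge0.
have kfin z : (nsum (fun x => `|tree_kernel o rho z x| * wt o rho x * phi x)%R < +oo)%E.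
  apply: le_lt_trans (kle z) _; have [jf _] := J z.
  by rewrite (nsum_fin_num (opz0 z) jf) -EFinM ltry.
split => //.
apply: (@le_trans _ _ (\esum_(z in [set: X])
   ((kernel_bound o rho `^ p * W `^ (p - 1))%:E *
    nsum (fun k => wt o sigma z * (omega z k * psi z k `^ p))%R)%E)).
  apply: le_esum => z _; have [jf jb] := J z.
  rewrite nsumZ ?wt_ge0//; move: jb.
  have := nsum_fin_num (op0 z) (fin z); move: (fine _) => n ->.
  rewrite -!EFinM !lee_fin => jb.
  have w0 := wt_ge0 o sigma0 z.
  rewrite mulrCA [leLHS]mulrC ler_wpM2l// -mulrA.
  apply: (@le_trans _ _ (kernel_bound o rho `^ p *
      fine (nsum (fun k => omega z k * psi z k)) `^ p)).
    rewrite -powRM ?(ltW kb)//; last by rewrite fine_ge0// nsum_ge0.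
    apply: ge0_ler_powR => //; rewrite ?nnegrE.
    - by rewrite fine_ge0// nsum_ge0.
    - by rewrite mulr_ge0 ?(ltW kb)// fine_ge0// nsum_ge0.
    - rewrite -lee_fin -(nsum_fin_num (k0 z) (kfin z)) EFinM -(nsum_fin_num (opz0 z) jf).
      exact: kle.
  by rewrite ler_wpM2l ?powR_ge0.
rewrite esumZl//; last 2 first.
- by rewrite mulr_ge0 ?powR_ge0.
- by move=> z; apply: nsum_ge0 => k; rewrite mulr_ge0// wt_ge0.
by rewrite [X in (X * B)%E]EFinM -muleA lee_wpmul2l// lee_fin mulr_ge0 ?powR_ge0.
Qed.

End Schur.

(** * Weighted spaces, the Bergman kernel and the operator *)

Section Bergman.
Local Open Scope complex_scope.
Context {R : realType} {q : nat} {X : homogeneous_tree q} (o : X).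
Hypothesis q1 : (1 < q)%N.
Local Notation "d| x |" := (gdist o x) (at level 0, x at level 99, format "d| x |").
Local Notation normc := ComplexField.Normc.normc.
Local Notation flow_harmonic := (flow_harmonic o).

(** In terms of [rate b] the weight is a plain power of the distance. *)
Definition rate (b : R) : R := q%:R `^ (- b).
Local Notation w b := (wt o (rate b)).
Local Notation K b := (tree_kernel o (rate b)).

Let q0 : (0 : R) < q%:R. Proof. by rewrite ltr0n; lia. Qed.
Let qn0 : (q%:R : R) != 0. Proof. by rewrite gt_eqF. Qed.
Let q1R : (1 : R) < q%:R. Proof. by rewrite ltr1n. Qed.

Lemma rate_gt0 b : 0 < rate b. Proof. exact: powR_gt0. Qed.

Lemma powq_lt1 (c : R) : c < 0 -> q%:R `^ c < 1.
Proof.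
move=> c0; have c0' : 0 < - c by rewrite oppr_gt0.
rewrite -[c]opprK powRN invf_lt1 ?powR_gt0//.
have := gt0_ltr_powR c0' _ _ q1R; rewrite powR1; apply; rewrite nnegrE//; exact: ltW.
Qed.

Lemma powqD (c d : R) : q%:R `^ (c + d) = q%:R `^ c * q%:R `^ d :> R.
Proof. by rewrite powRD// qn0 implybT. Qed.

Lemma q_rate_lt1 b : 1 < b -> q%:R * rate b < 1.
Proof.
move=> b1; rewrite -{1}[q%:R](powRr1 (ltW q0)) -powqD.
by apply: powq_lt1; lra.
Qed.

Lemma weightE b x : weight o b x = w b x.
Proof. by rewrite /weight /wt /rate powRrM powR_mulrn// powR_ge0. Qed.

Lemma w_ge0 b x : 0 <= w b x. Proof. exact: wt_ge0 (rate_gt0 b) _. Qed.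

Lemma powsumE p b (f : X -> R[i]) :
  wLp_powsum o p b f = nsum (fun x => normc (f x) `^ p * w b x).
Proof. by rewrite /wLp_powsum /nsum; apply: eq_esum => x _; rewrite weightE. Qed.

Lemma powterm_ge0 p b (f : X -> R[i]) x : 0 <= normc (f x) `^ p * w b x.
Proof. by rewrite mulr_ge0 ?powR_ge0 ?w_ge0. Qed.

Lemma wL2P b (f : X -> R[i]) :
  wLp o 2 b f = (nsum (fun x => normc (f x) ^+ 2 * w b x)%R < +oo)%E :> Prop.
Proof.
rewrite /wLp /= powsumE; congr (is_true (nsum _ < _)%E); apply/funext => x.
by rewrite powR_mulrn// normc_ge0.
Qed.

(** The Cauchy-Schwarz inequality in its weak form [2 s t <= s^2 + t^2]. *)
Lemma wL2_prod b (f g : X -> R[i]) : wLp o 2 b f -> wLp o 2 b g ->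
  (nsum (fun x => normc (f x) * normc (g x) * w b x)%R < +oo)%E.
Proof.
rewrite !wL2P => fs gs; have := lte_add_pinfty fs gs.
have t0 (h : X -> R[i]) x : 0 <= normc (h x) ^+ 2 * w b x by rewrite mulr_ge0 ?sqr_ge0 ?w_ge0.
rewrite -nsumD//; apply: le_lt_trans; apply: le_nsum => x.
rewrite -mulrDl; apply: ler_wpM2r; first exact: w_ge0.
have := normc_ge0 (f x); have := normc_ge0 (g x); nra.
Qed.

Lemma wL2_cst b (c : R[i]) : 1 < b -> wLp o 2 b (fun=> c).
Proof.
move=> b1; rewrite wL2P nsumZ ?sqr_ge0//; last by move=> x; exact: w_ge0.
have wf := wt_fin o q1 (rate_gt0 b) (q_rate_lt1 b1).
by rewrite (nsum_fin_num _ wf) -?EFinM ?ltry// => x; exact: w_ge0.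
Qed.

Lemma wL2_le b (f g : X -> R[i]) : (forall x, normc (f x) <= normc (g x)) ->
  wLp o 2 b g -> wLp o 2 b f.
Proof.
rewrite !wL2P => fg; apply: le_lt_trans; apply: le_nsum => x.
by rewrite ler_wpM2r ?w_ge0// ler_sqr ?nnegrE ?normc_ge0.
Qed.

Lemma wL2_summable b (f : X -> R[i]) : 1 < b -> wLp o 2 b f ->
  (nsum (fun x => normc (f x) * w b x)%R < +oo)%E.
Proof.
move=> b1 fs; have := wL2_prod fs (wL2_cst 1 b1).
by congr (_ < _)%E; congr nsum; apply/funext => x; rewrite ComplexField.Normc.normc1 mulr1.
Qed.

Lemma wL2B b (f g : X -> R[i]) : wLp o 2 b f -> wLp o 2 b g ->
  wLp o 2 b (fun x => f x - g x).
Proof.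
rewrite !wL2P => fs gs.
have t0 (h : X -> R[i]) x : 0 <= 2 * (normc (h x) ^+ 2 * w b x).
  by rewrite mulr_ge0// mulr_ge0 ?sqr_ge0 ?w_ge0.
have h2 (h : X -> R[i]) : (nsum (fun x => normc (h x) ^+ 2 * w b x)%R < +oo ->
    nsum (fun x => 2 * (normc (h x) ^+ 2 * w b x))%R < +oo)%E.
  have t x : 0 <= normc (h x) ^+ 2 * w b x by rewrite mulr_ge0 ?sqr_ge0 ?w_ge0.
  by move=> hs; rewrite nsumZ// (nsum_fin_num _ hs) -?EFinM ?ltry.
have := lte_add_pinfty (h2 _ fs) (h2 _ gs); rewrite -nsumD//.
apply: le_lt_trans; apply: le_nsum => x.
rewrite -mulrDr -mulrDl mulrA; apply: ler_wpM2r; first exact: w_ge0.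
have := le_normcD (f x) (- g x); rewrite normcN.
move: (normc_ge0 (f x - g x)).
move: (normc (f x - g x)) (normc (f x)) (normc (g x)) => d a c d0 dac.
have : d ^+ 2 <= (a + c) ^+ 2 by rewrite ler_sqr ?nnegrE//; exact: le_trans d0 dac.
have := sqr_ge0 (a - c); rewrite !expr2; lra.
Qed.

Lemma wA2B b (f g : X -> R[i]) : wAp o 2 b f -> wAp o 2 b g ->
  wAp o 2 b (fun x => f x - g x).
Proof.
move=> [fs /(harmonic_flowP o) fh] [gs /(harmonic_flowP o) gh]; split; first exact: wL2B.
by apply/(harmonic_flowP o); exact: flowB.
Qed.

Lemma mulcJ (z : R[i]) : z * z^* = (normc z ^+ 2)%:C.
Proof.
case: z => a c /=; rewrite sqr_sqrtr ?addr_ge0 ?sqr_ge0//.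
by congr (_ +i* _); rewrite ?expr2; ring.
Qed.

Lemma wL2_definite b (f : X -> R[i]) : wLp o 2 b f ->
  csum (fun x => f x * (f x)^* * (weight o b x)%:C) = 0 -> f = fun=> 0.
Proof.
rewrite wL2P => fs.
have -> : (fun x => f x * (f x)^* * (weight o b x)%:C) =
    fun x => (normc (f x) ^+ 2 * w b x)%:C.
  by apply/funext => x; rewrite mulcJ weightE -rmorphM.
have t x : 0 <= normc (f x) ^+ 2 * w b x by rewrite mulr_ge0 ?sqr_ge0 ?w_ge0.
rewrite csum_real rsum_nneg// => -[fz]; apply/funext => x.
have := nsum_ge x t; rewrite (nsum_fin_num t fs) fz lee_fin => le0.
have : normc (f x) ^+ 2 * w b x = 0 by apply/eqP; rewrite eq_le le0 t.
move/eqP; rewrite mulf_eq0 [w b x == 0]gt_eqF; last exact: wt_gt0 (rate_gt0 b) _.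
by rewrite orbF expf_eq0 /= => /eqP /ComplexField.Normc.eq0_normc.
Qed.

Lemma kernel_L2 b z : 1 < b -> wAp o 2 b (fun x => (K b z x)%:C).
Proof.
move=> b1; have rb := rate_gt0 b; have qr := q_rate_lt1 b1; split.
  pose B := kernel_bound o (rate b) * \sum_(0 <= j < d|z|.+1) rate b ^- j.
  apply: (wL2_le _ (wL2_cst B%:C b1)) => x; rewrite !normc_real.
  apply: (le_trans (norm_kernel_le o q1 rb qr z x)); apply: le_trans (ler_norm _).
  rewrite ler_wpM2l ?(ltW (kernel_bound_gt0 o q1 rb qr))//.
  apply: ler_sum => j _; rewrite -[leRHS]mulr1 ler_wpM2l ?invr_ge0 ?exprn_ge0 ?(ltW rb)//.
  by case: (below _ _ _).
apply/(harmonic_flowP o)/(flow_ReIm o); split; first exact: kernel_flow.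
exact: flow_cst.
Qed.

Lemma kernel_reproduces b z (g : X -> R[i]) : 1 < b -> wAp o 2 b g ->
  csum (fun x => g x * (K b z x)%:C * (w b x)%:C) = g z.
Proof.
move=> b1 [gs /(harmonic_flowP o)/(flow_ReIm o)[gr gi]].
have rb := rate_gt0 b; have qr := q_rate_lt1 b1.
have g1 := wL2_summable b1 gs.
have sre : rsummable (fun x => complex.Re (g x) * w b x).
  apply: le_lt_trans g1; apply: le_nsum => x; rewrite normrM (ger0_norm (w_ge0 b x)).
  by apply: ler_wpM2r (normRe_le _); exact: w_ge0.
have sim : rsummable (fun x => complex.Im (g x) * w b x).
  apply: le_lt_trans g1; apply: le_nsum => x; rewrite normrM (ger0_norm (w_ge0 b x)).
  by apply: ler_wpM2r (normIm_le _); exact: w_ge0.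
have := kernel_reproducing q1 rb qr z gr sre; have := kernel_reproducing q1 rb qr z gi sim.
rewrite /csum => ei er; rewrite [RHS]complexE.
transitivity (complex.Re (g z) +i* complex.Im (g z)); last by case: (g z) => a c; rewrite -complexE.
rewrite -er -ei; congr (_ +i* _); congr rsum; apply/funext => x;
  by case: (g x) => a c /=; ring.
Qed.

(** Uniqueness: the difference [D] of two reproducing kernels at [z] is in [A^2_b],
    and both reproduce [D z], so [D] is orthogonal to itself. *)
Lemma bergman_kernelE b : 1 < b -> bergman_kernel o b = K b.
Proof.
move=> b1; rewrite /bergman_kernel; case: xgetP => [K' _ HK'|]; last first.
  move=> /(_ (K b)); case=> z; split; first exact: kernel_L2.
  move=> g gA; rewrite -[RHS](kernel_reproduces z b1 gA).
  by congr csum; apply/funext => x; rewrite weightE.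
apply/funext => z; have [KA' Krep'] := HK' z; have KA := kernel_L2 z b1.
have DA := wA2B KA' KA.
pose D x := (K' z x)%:C - (K b z x)%:C.
suff D0 : csum (fun x => D x * (D x)^* * (weight o b x)%:C) = 0.
  have /(congr1 (@^~ _)) D00 := wL2_definite DA.1 D0.
  apply/funext => x; have := D00 x; rewrite /= -rmorphB => -[] /eqP.
  by rewrite subr_eq0 => /eqP.
have e1 : csum (fun x => D x * (K' z x)%:C * (weight o b x)%:C) = D z := Krep' _ DA.
have e2 : csum (fun x => D x * (K b z x)%:C * (weight o b x)%:C) = D z.
  rewrite -[RHS](kernel_reproduces z b1 DA).
  by congr csum; apply/funext => x; rewrite weightE.
have sm (h : X -> R) : wLp o 2 b (fun x => (h x)%:C) ->
    csummable (fun x => D x * (h x)%:C * (weight o b x)%:C).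
  move=> hs; apply: csummable_le (wL2_prod DA.1 hs) => x.
  rewrite !ComplexField.Normc.normcM (normc_real (weight o b x)) weightE.
  by rewrite (ger0_norm (w_ge0 b x)).
have -> : (fun x => D x * (D x)^* * (weight o b x)%:C) = (fun x =>
   D x * (K' z x)%:C * (weight o b x)%:C + (-1) * (D x * (K b z x)%:C * (weight o b x)%:C)).
  apply/funext => x; rewrite [X in _ * X * _ = _](_ : _ = D x).
    by rewrite {2}/D; ring.
  rewrite /D -rmorphB; exact: conjc_real.
rewrite csumD; [|exact: sm KA'.1|exact: csummableZ (sm _ KA.1)].
by rewrite csumZ ?e1 ?e2 ?mulN1r ?subrr//; exact: sm KA.1.
Qed.

(** Here the factors [q^((a-b)|x|)] and [q^(-a|x|)] are merged: the operator depends
    on [a] only through the space on which it acts. *)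
Definition bergman_op b (f : X -> R[i]) z : R[i] := csum (fun x => (K b z x * w b x)%:C * f x).

Lemma bergman_type_opE a b f z : 1 < b -> bergman_type_op o a b f z = bergman_op b f z.
Proof.
move=> b1; rewrite /bergman_type_op /bergman_op bergman_kernelE//; congr csum; apply/funext => x.
have -> : w b x = q%:R `^ ((a - b) * d|x|%:R) * weight o a x.
  by rewrite -weightE /weight -powqD; congr (_ `^ _); ring.
by rewrite !rmorphM /=; ring.
Qed.

(** With [tau = q^-t] and [theta = q^-d] the conditions read [t > 1], [d > 0],
    [(p - 1) d < a - 1] and [(p - 1) t < p b - a]. *)
Lemma schur_exponents (p a b : R) : 1 <= p -> 1 < a -> 1 < b -> a - 1 < p * (b - 1) ->
  exists tau theta : R, [/\ [/\ 0 < tau, q%:R * tau < 1, 0 < theta & theta < 1],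
    q%:R * (theta * (theta^-1) `^ p * rate a) < 1 &
    tau * (rate b / tau) `^ p / rate a < 1].
Proof.
move=> p1 a1 b1 cond; have p0 : 0 < p by lra.
(* the slack of the hypothesis, divided by [p] rather than [p - 1] so that [p = 1]
   needs no separate treatment *)
pose e := (p * (b - 1) - (a - 1)) / p; have e0 : 0 < e by rewrite divr_gt0//; lra.
have pe : p * e = p * (b - 1) - (a - 1) by rewrite /e mulrCA mulfV ?mulr1// gt_eqF.
pose d := (a - 1) / p; have d0 : 0 < d by rewrite divr_gt0//; lra.
have pd : p * d = a - 1 by rewrite /d mulrCA mulfV ?mulr1// gt_eqF.
exists (rate (1 + e)), (rate d).
have rN c : (rate c)^-1 = q%:R `^ c by rewrite /rate -powRN opprK.
split; first split.
- exact: rate_gt0.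
- by apply: q_rate_lt1; lra.
- exact: rate_gt0.
- by apply: powq_lt1; lra.
- rewrite rN -powRrM /rate -!powqD -{1}[q%:R](powRr1 (ltW q0)) -powqD.
  by apply: powq_lt1; lra.
- rewrite !rN /rate -powqD -powRrM -!powqD.
  by apply: powq_lt1; nra.
Qed.

Section Bounded.
Variables (p a b : R).
Hypotheses (p1 : 1 <= p) (a1 : 1 < a) (b1 : 1 < b) (cond : a - 1 < p * (b - 1)).

Lemma abs_bergman_op_bound : exists M : R, 0 <= M /\ forall f : X -> R[i], wLp o p a f ->
  (forall z, (nsum (fun x => `|K b z x| * w b x * normc (f x))%R < +oo)%E) /\
  (nsum (fun z => fine (nsum (fun x => `|K b z x| * w b x * normc (f x))) `^ p * w a z)%R
     <= M%:E * nsum (fun x => normc (f x) `^ p * w a x)%R)%E.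
Proof.
have [tau [theta [[t0 qt th0 th1] c1 c2]]] := schur_exponents p1 a1 b1 cond.
eexists; split; last first.
  move=> f; rewrite /wLp /= powsumE => fs.
  exact: (schur_bound q1 (rate_gt0 b) (q_rate_lt1 b1) p1 (rate_gt0 a) t0 qt th0 th1 c1 c2
    (fun x => normc_ge0 (f x)) fs).
rewrite !mulr_ge0 ?powR_ge0//.
- by rewrite invr_ge0 subr_ge0 ltW.
- by rewrite invr_ge0 subr_ge0 ltW.
Qed.

Lemma normc_kterm z x (f : X -> R[i]) :
  normc ((K b z x * w b x)%:C * f x) = `|K b z x| * w b x * normc (f x).
Proof.
by rewrite ComplexField.Normc.normcM normc_real normrM (ger0_norm (w_ge0 b x)).
Qed.

Lemma bergman_op_summable z f : wLp o p a f -> csummable (fun x => (K b z x * w b x)%:C * f x).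
Proof.
move=> fs; have [M [_ /(_ f fs)[/(_ z) H _]]] := abs_bergman_op_bound.
by apply: le_lt_trans H; apply: le_nsum => x; rewrite normc_kterm.
Qed.

Lemma bergman_op_linear (c : R[i]) f g : wLp o p a f -> wLp o p a g ->
  bergman_op b (fun x => c * f x + g x) = (fun z => c * bergman_op b f z + bergman_op b g z).
Proof.
move=> fs gs; apply/funext => z; rewrite /bergman_op.
rewrite -csumZ; last exact: bergman_op_summable.
rewrite -csumD; [|apply: csummableZ; exact: bergman_op_summable|exact: bergman_op_summable].
by congr csum; apply/funext => x; ring.
Qed.

(** The kernel is harmonic in its first variable by symmetry, and the condition at
    a vertex involves only finitely many values. *)
Lemma bergman_op_harmonic f : wLp o p a f -> flow_harmonic (bergman_op b f).
Proof.
move=> fs v; rewrite /bergman_op.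
pose F z x := (K b z x * w b x)%:C * f x.
have Fs z : csummable (F z) by exact: bergman_op_summable.
have FB z y : csum (F z) - csum (F y) = csum (fun x => F z x - F y x).
  rewrite -mulN1r -csumZ// -csumD//; last exact: csummableZ.
  by congr csum; apply/funext => x; rewrite mulN1r.
have FBs z y : csummable (fun x => F z x - F y x).
  have := csummableD (Fs z) (csummableZ (-1) (Fs y)).
  by congr csummable; apply/funext => x; rewrite mulN1r.
rewrite (eq_bigr (fun u => csum (fun x => F u x - F v x))) => [|u _]; last exact: FB.
rewrite FB -csum_sum//; congr csum; apply/funext => x; rewrite /F.
have Kh : flow_harmonic (fun z => K b z x).
  have -> : (fun z => K b z x) = K b x.
    by apply/funext => z; rewrite kernel_sym.
  exact: kernel_flow.
rewrite (eq_bigr (fun u => (w b x)%:C * f x * (K b u x - K b v x)%:C)) => [|u _].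
  rewrite -mulr_sumr -(rmorph_sum (real_complex R)) /= Kh.
  by rewrite !rmorphM !rmorphB /=; ring.
by rewrite !rmorphM !rmorphB /=; ring.
Qed.

Lemma bergman_op_bounded : exists M : R, 0 <= M /\ forall f, wLp o p a f ->
  wLp o p a (bergman_op b f) /\ wLp_norm o p a (bergman_op b f) <= M * wLp_norm o p a f.
Proof.
have [M [M0 H]] := abs_bergman_op_bound; have p0 : 0 < p := lt_le_trans ltr01 p1.
exists ((2 `^ p * M) `^ p^-1); split; first exact: powR_ge0.
move=> f fs; have [Hs Hb] := H f fs.
have fs' : (nsum (fun x => normc (f x) `^ p * w a x)%R < +oo)%E by rewrite -powsumE.
set B := fine (nsum (fun x => normc (f x) `^ p * w a x)).
have BE : nsum (fun x => normc (f x) `^ p * w a x) = B%:E.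
  by rewrite /B -nsum_fin_num// => x; exact: powterm_ge0.
have B0 : 0 <= B by rewrite fine_ge0// nsum_ge0// => x; exact: powterm_ge0.
have kb : (nsum (fun z => normc (bergman_op b f z) `^ p * w a z)%R <= (2 `^ p * M * B)%:E)%E.
  rewrite -mulrA; apply: (@le_trans _ _ (nsum (fun z => 2 `^ p *
    (fine (nsum (fun x => `|K b z x| * w b x * normc (f x))) `^ p * w a z))%R)).
    apply: le_nsum => z; rewrite mulrA; apply: ler_wpM2r; first exact: w_ge0.
    have n0 : 0 <= fine (nsum (fun x => `|K b z x| * w b x * normc (f x))).
      by rewrite fine_ge0// nsum_ge0// => x; rewrite !mulr_ge0 ?normc_ge0 ?w_ge0.
    rewrite -powRM//; apply: ge0_ler_powR; rewrite ?nnegrE ?normc_ge0 ?mulr_ge0 ?(ltW p0)//.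
    apply: le_trans (normc_csum_le (bergman_op_summable z fs)) _.
    by under eq_fun => x do rewrite normc_kterm.
  apply: nsumZ_le; first exact: powR_ge0.
    by move=> z; rewrite mulr_ge0 ?powR_ge0 ?w_ge0.
  by rewrite BE -EFinM in Hb.
have ks : (nsum (fun z => normc (bergman_op b f z) `^ p * w a z)%R < +oo)%E.
  by apply: le_lt_trans kb _; rewrite ltry.
split; first by rewrite /wLp /= powsumE.
rewrite /wLp_norm !powsumE -powRM ?mulr_ge0 ?powR_ge0//.
apply: ge0_ler_powR; rewrite ?nnegrE ?invr_ge0 ?(ltW p0)//.
- by rewrite fine_ge0// nsum_ge0// => x; exact: powterm_ge0.
- by rewrite !mulr_ge0 ?powR_ge0.
- rewrite -lee_fin -nsum_fin_num//; exact: powterm_ge0.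
Qed.

End Bounded.

End Bergman.

(** * The Bergman projector *)

Section Projector.
Local Open Scope complex_scope.
Context {R : realType} {q : nat} {X : homogeneous_tree q} (o : X).
Hypothesis q1 : (1 < q)%N.
Local Notation "d| x |" := (gdist o x) (at level 0, x at level 99, format "d| x |").
Local Notation normc := ComplexField.Normc.normc.
Local Notation flow_harmonic := (flow_harmonic o).
Local Notation w b := (wt o (@rate R q b)).
Local Notation K b := (tree_kernel o (@rate R q b)).

Variable (a : R).
Hypothesis a1 : 1 < a.

Let two1 : (1 : R) <= 2. Proof. by rewrite ler1n. Qed.
Let cond : a - 1 < 2 * (a - 1). Proof. by rewrite ltr_pMl ?subr_gt0// ltr1n. Qed.

(** The case [p = 2], [b = a] of the norm estimate, whose condition is [a > 1]. *)
Lemma bergman_op_wA2 f : wLp o 2 a f -> wAp o 2 a (bergman_op o a f).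
Proof.
move=> fs; split; last first.
  by apply/(harmonic_flowP o); exact: (bergman_op_harmonic q1 two1 a1 a1 cond).
by have [M [_ /(_ f fs)[]]] := bergman_op_bounded o q1 two1 a1 a1 cond.
Qed.

Lemma csummable_inner f h : wLp o 2 a f -> wLp o 2 a h ->
  csummable (fun x => f x * (h x)^* * (weight o a x)%:C).
Proof.
move=> fs hs; apply: csummable_le (wL2_prod q1 fs hs) => x.
rewrite !ComplexField.Normc.normcM normc_conj (normc_real (weight o a x)) weightE.
by rewrite (ger0_norm (w_ge0 o q1 a x)).
Qed.

Lemma wL2_innerB f g h : wLp o 2 a f -> wLp o 2 a g -> wLp o 2 a h ->
  wL2_inner o a (fun x => f x - g x) h = wL2_inner o a f h - wL2_inner o a g h.
Proof.
move=> fs gs hs; rewrite /wL2_inner -mulN1r -csumZ; last exact: csummable_inner.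
rewrite -csumD; [|exact: csummable_inner|apply: csummableZ; exact: csummable_inner].
by congr csum; apply/funext => x; ring.
Qed.

Lemma conjM_real (z : R[i]) (c d : R) : conjc (z * c%:C * d%:C) = z^* * c%:C * d%:C.
Proof. by case: z => x y /=; congr (_ +i* _); ring. Qed.

(** Fubini's theorem moves the kernel to [h], which it reproduces.  The absolute
    convergence needed follows from the estimate for the kernel with absolute
    values, which maps [|f|] into [L^2_a]. *)
Lemma wL2_inner_bergman_op f h : wLp o 2 a f -> wAp o 2 a h ->
  wL2_inner o a (bergman_op o a f) h = wL2_inner o a f h.
Proof.
move=> fs hA; rewrite /wL2_inner.
pose F z x := (K a z x * w a x)%:C * f x * ((h z)^* * (weight o a z)%:C).
pose S z := fine (nsum (fun x => `|K a z x| * w a x * normc (f x))).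
have [M [M0 /(_ f fs) [Sfin Sb]]] := abs_bergman_op_bound o q1 two1 a1 a1 cond.
have S0 z : 0 <= S z.
  by rewrite fine_ge0// nsum_ge0// => x; rewrite !mulr_ge0 ?normc_ge0 ?w_ge0.
have SL2 : wLp o 2 a (fun z => (S z)%:C).
  rewrite /wLp /= powsumE.
  have -> : (fun x => normc (S x)%:C `^ 2 * w a x) = fun x => S x `^ 2 * w a x.
    by apply/funext => x; rewrite normc_real ger0_norm.
  apply: le_lt_trans Sb _; move: (fs); rewrite /wLp /= powsumE => fs'.
  by rewrite (nsum_fin_num _ fs') -?EFinM ?ltry// => x; exact: powterm_ge0.
have Fub : (\esum_(z in [set: X]) nsum (fun x => normc (F z x)) < +oo)%E.
  apply: le_lt_trans (wL2_prod q1 SL2 hA.1); apply: le_esum => z _.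
  rewrite normc_real ger0_norm//.
  have -> : (fun x => normc (F z x)) = fun x => (normc (h z) * w a z) *
       (`|K a z x| * w a x * normc (f x)).
    apply/funext => x; rewrite /F ComplexField.Normc.normcM (normc_kterm o q1).
    rewrite ComplexField.Normc.normcM normc_conj normc_real weightE.
    by rewrite (ger0_norm (w_ge0 o q1 a z)) mulrC.
  have t0 x : 0 <= `|K a z x| * w a x * normc (f x).
    by rewrite !mulr_ge0 ?normc_ge0 ?w_ge0.
  rewrite nsumZ ?mulr_ge0 ?normc_ge0 ?w_ge0// (nsum_fin_num t0 (Sfin z)) -EFinM lee_fin.
  by rewrite -/(S z) mulrC mulrA.
transitivity (csum (fun z => csum (F z))).
  congr csum; apply/funext => z; rewrite /bergman_op -mulrA mulrC -csumZ.
    by congr csum; apply/funext => x; rewrite /F mulrC.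
  exact: (bergman_op_summable q1 two1 a1 a1 cond).
rewrite csum_swap//; congr csum; apply/funext => x.
have hx := kernel_reproduces q1 x a1 hA.
have sx : csummable (fun z => (h z * (K a x z)%:C * (w a z)%:C)^*).
  apply: csummable_le (wL2_prod q1 hA.1 (kernel_L2 o q1 x a1).1) => z.
  rewrite normc_conj !ComplexField.Normc.normcM (normc_real (w a z)).
  by rewrite (ger0_norm (w_ge0 o q1 a z)).
transitivity (csum (fun z => (w a x)%:C * f x * conjc (h z * (K a x z)%:C * (w a z)%:C))).
  congr csum; apply/funext => z; rewrite /F (kernel_sym _ _ z x) weightE conjM_real rmorphM /=.
  by ring.
by rewrite csumZ// csum_conj hx weightE [(w a x)%:C * _]mulrC mulrAC.
Qed.

Lemma bergman_projectorE f : wLp o 2 a f -> bergman_projector o a f = bergman_op o a f.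
Proof.
move=> fs; have kA := bergman_op_wA2 fs.
have orth h : wAp o 2 a h -> wL2_inner o a (fun x => f x - bergman_op o a f x) h = 0.
  by move=> hA; rewrite (wL2_innerB fs kA.1 hA.1) (wL2_inner_bergman_op fs hA) subrr.
rewrite /bergman_projector; case: xgetP => [g _ [gA go]|/(_ (bergman_op o a f)) []//].
have DA := wA2B q1 gA kA.
suff /(wL2_definite q1 DA.1) D0 : csum (fun x =>
    (g x - bergman_op o a f x) * (g x - bergman_op o a f x)^* *
     (weight o a x)%:C) = 0.
  apply/funext => x; apply/eqP; rewrite -subr_eq0; apply/eqP.
  exact: (congr1 (@^~ x) D0).
rewrite -[LHS]/(wL2_inner o a (fun x => g x - bergman_op o a f x) _).
have := go _ DA; have := orth _ DA.
rewrite (wL2_innerB fs gA.1 DA.1) (wL2_innerB fs kA.1 DA.1) (wL2_innerB gA.1 kA.1 DA.1).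
by move=> /subr0_eq -> /subr0_eq ->; rewrite subrr.
Qed.

End Projector.

(** * Necessity of the exponent condition *)

Section Necessity.
Local Open Scope complex_scope.
Context {R : realType} {q : nat} {X : homogeneous_tree q} (o : X).
Hypothesis q1 : (1 < q)%N.
Local Notation "d| x |" := (gdist o x) (at level 0, x at level 99, format "d| x |").
Local Notation normc := ComplexField.Normc.normc.
Local Notation rate := (@rate R q).
Local Notation w b := (wt o (rate b)).
Local Notation K b := (tree_kernel o (rate b)).
Local Notation desc := (desc o).
Local Notation anc := (anc o).

Let q0 : (0 : R) < q%:R. Proof. by rewrite ltr0n; lia. Qed.

Lemma nsum_radial (phi : nat -> R) n : (forall k, 0 <= phi k) ->
  nsum (fun x => (d|x| <= n)%N%:R * phi d|x|) =
  (\sum_(0 <= k < n.+1) (size (desc o k))%:R * phi k)%:E.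
Proof.
move=> p0.
have -> : (fun x => (d|x| <= n)%N%:R * phi d|x|) =
    fun x => (below o o x)%:R * ((d|x| <= n)%N%:R * phi d|x|).
  by apply/funext => x; rewrite below_o mul1r.
rewrite nsum_below; last by move=> x; rewrite mulr_ge0.
rewrite -nsum_seq ?iota_uniq//; last by move=> k; rewrite mulr_ge0.
congr nsum; apply/funext => k; rewrite mem_index_iota ltnS /=.
rewrite (eq_big_seq (fun=> (k <= n)%N%:R * phi k)); last first.
  by move=> x; rewrite mem_desc gdist_oo subn0 => /andP[_ /eqP <-].
by rewrite big_const_seq count_predT iter_addr_0 -[LHS]mulr_natl mulrCA.
Qed.

Lemma desc_nonempty n : exists y : X, d|y| = n.
Proof.
have := size_desc_ge o n q1; case E : (desc o n) => [|y s].
  by rewrite /= leqNgt expn_gt0 (ltnW q1).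
move=> _; exists y; have : y \in desc o n by rewrite E mem_head.
by rewrite mem_desc gdist_oo subn0 => /andP[_ /eqP].
Qed.

Variables (p a b : R).
Hypotheses (p1 : 1 <= p) (a1 : 1 < a) (b1 : 1 < b).
Variable M : R.
Hypothesis bounded : forall f, wLp o p a f -> wLp o 2 b f ->
  wLp o p a (bergman_op o b f) /\ wLp_norm o p a (bergman_op o b f) <= M * wLp_norm o p a f.

Let p0 : 0 < p := lt_le_trans ltr01 p1.

(** The norm inequality raised to the power [p]; the absolute value covers a
    negative [M]. *)
Lemma powsum_bounded f : wLp o p a f -> wLp o 2 b f ->
  (wLp_powsum o p a (bergman_op o b f) <= (`|M| `^ p)%:E * wLp_powsum o p a f)%E.
Proof.
move=> fs f2; have [ks] := bounded fs f2; rewrite /wLp_norm.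
move: fs ks; rewrite /wLp /= !powsumE => fs ks.
have t0 h x := powterm_ge0 o q1 p a h x.
rewrite (nsum_fin_num (t0 _) fs) (nsum_fin_num (t0 _) ks) -EFinM lee_fin.
have fE (r : R) : fine r%:E = r by [].
rewrite !fE.
set B := fine _; set A := fine (nsum (fun x => normc (f x) `^ p * w a x)).
have B0 : 0 <= B by apply: fine_ge0; apply: nsum_ge0; exact: t0.
have A0 : 0 <= A by apply: fine_ge0; apply: nsum_ge0; exact: t0.
clearbody A B; clear fE t0 fs ks.
have pK c : 0 <= c -> (c `^ p^-1) `^ p = c.
  by move=> c0; rewrite -powRrM mulVf ?gt_eqF// powRr1.
move=> H; have : B `^ p^-1 <= `|M| * A `^ p^-1.
  by apply: le_trans H _; rewrite ler_wpM2r ?powR_ge0 ?ler_norm.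
move=> /(ge0_ler_powR (ltW p0)); rewrite !nnegrE mulr_ge0 ?powR_ge0// => /(_ isT isT).
by rewrite (powRM _ (normr_ge0 _) (powR_ge0 _ _)) (pK B B0) (pK A A0).
Qed.

(** Testing on [q^((b-1)|x|)] truncated at distance [n]: each sphere contributes at
    least a fixed amount to the value at [o], and at most 2 to the [p]-th power of
    the norm, so that [(n+1)^p] is at most a constant times [n+1]. *)
Lemma necessity_gt1 : 1 < p -> a - 1 < p * (b - 1).
Proof.
move=> pgt1; rewrite ltNge; apply/negP => cond.
have rb := @rate_gt0 R q q1 b; have qrb := q_rate_lt1 q1 b1.
have C0 := mass_gt0 o q1 rb qrb; set C := mass o (rate b) in C0.
pose c x : R := q%:R `^ ((b - 1) * d|x|%:R).
pose f n x : R[i] := ((d|x| <= n)%N%:R * c x)%:C.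
have nf n x : normc (f n x) = (d|x| <= n)%N%:R * c x.
  by rewrite normc_real ger0_norm// mulr_ge0// powR_ge0.
have rE s k : rate s ^+ k = q%:R `^ (- s * k%:R) by rewrite /rate powRrM powR_mulrn// powR_ge0.
have cut n r s : 0 < r -> (fun x => normc (f n x) `^ r * w s x) =
   fun x => (d|x| <= n)%N%:R * q%:R `^ ((r * (b - 1) - s) * d|x|%:R).
  move=> r0; apply/funext => x; rewrite nf /wt rE.
  case: (d|x| <= n)%N; rewrite ?mul0r ?mul1r ?powR0 ?mul0r ?gt_eqF//.
  by rewrite /c -powRrM -powqD//; congr (_ `^ _); ring.
have fL n r s : 0 < r -> wLp o r s (f n).
  move=> r0; rewrite /wLp /= powsumE cut//.
  rewrite (@nsum_radial (fun k => q%:R `^ ((r * (b - 1) - s) * k%:R)) n) ?ltry// => k;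
    exact: powR_ge0.
have up n : (wLp_powsum o p a (f n) <= (2 * n.+1%:R)%:E)%E.
  rewrite powsumE cut// (@nsum_radial (fun k => q%:R `^ ((p * (b - 1) - a) * k%:R)) n); last first.
    by move=> k; exact: powR_ge0.
  rewrite lee_fin.
  apply: (@le_trans _ _ (\sum_(0 <= k < n.+1) 2)); last first.
    by rewrite big_const_nat iter_addr_0 subn0 mulr_natr.
  apply: ler_sum_nat => k _.
  apply: (@le_trans _ _ (2 * q%:R ^+ k * q%:R `^ ((p * (b - 1) - a) * k%:R))).
    by rewrite ler_wpM2r ?powR_ge0// -natrX -natrM ler_nat size_desc_le.
  rewrite -mulrA -[leRHS]mulr1 ler_wpM2l// -powR_mulrn// -powqD//.
  have : (k%:R + (p * (b - 1) - a) * k%:R : R) <= 0 by have : (0 : R) <= k%:R by []; nra.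
  rewrite le_eqVlt => /predU1P[->|/(powq_lt1 q1)/ltW//].
  by rewrite powRr0.
have low n : (C^-1 * n.+1%:R) `^ p <= normc (bergman_op o b (f n) o) `^ p.
  apply: ge0_ler_powR; rewrite ?nnegrE ?normc_ge0 ?mulr_ge0 ?invr_ge0 ?(ltW C0) ?(ltW p0)//.
  have -> : bergman_op o b (f n) o =
      (rsum (fun x => C^-1 * ((d|x| <= n)%N%:R * q%:R `^ (- 1 * d|x|%:R))))%:C.
    rewrite -csum_real; congr csum; apply/funext => x.
    rewrite kernel_o -rmorphM /wt rE /= -/C -[in LHS]mulrA [_ * (_ * c x)]mulrCA.
    congr ((_ * (_ * _))%:C).
    by rewrite -powqD//; congr (_ `^ _); ring.
  have t0 x : 0 <= (d|x| <= n)%N%:R * q%:R `^ (- 1 * d|x|%:R) :> R.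
    by rewrite mulr_ge0// powR_ge0.
  have tE := @nsum_radial (fun k => q%:R `^ (- 1 * k%:R)) n (fun k => powR_ge0 _ _).
  rewrite rsumZ; last by rewrite rsummable_nneg// tE ltry.
  rewrite rsum_nneg ?tE ?ltry//= expr0n /= addr0 sqrtr_sqr ger0_norm; last first.
    apply: mulr_ge0; first by rewrite invr_ge0 ltW.
    by apply: sumr_ge0 => k _; rewrite mulr_ge0// powR_ge0.
  rewrite ler_wpM2l ?invr_ge0 ?(ltW C0)//.
  apply: (@le_trans _ _ (\sum_(0 <= k < n.+1) 1)).
    by rewrite big_const_nat iter_addr_0 subn0.
  apply: ler_sum_nat => k _.
  rewrite mulN1r powRN powR_mulrn// ler_pdivlMr ?exprn_gt0// mul1r -natrX ler_nat.
  exact: size_desc_ge.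
have key n : (C^-1 * n.+1%:R) `^ p <= `|M| `^ p * (2 * n.+1%:R).
  rewrite -lee_fin EFinM; apply: (@le_trans _ _ (wLp_powsum o p a (bergman_op o b (f n)))).
    apply: (@le_trans _ _ (normc (bergman_op o b (f n) o) `^ p)%:E); first by rewrite lee_fin.
    have -> : normc (bergman_op o b (f n) o) `^ p = normc (bergman_op o b (f n) o) `^ p * w a o.
      by rewrite /wt gdist_oo expr0 mulr1.
    by rewrite powsumE; apply: (nsum_ge o (powterm_ge0 o q1 p a (bergman_op o b (f n)))).
  apply: le_trans (powsum_bounded (fL n _ _ p0) (fL n _ _ _)) _ => //.
  by rewrite lee_wpmul2l// lee_fin powR_ge0.
pose L := `|M| `^ p * 2 * C `^ p.
have L0 : 0 <= L by rewrite !mulr_ge0 ?powR_ge0.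
have key2 n : n.+1%:R `^ (p - 1) <= L.
  have n0 : 0 < n.+1%:R :> R by [].
  have := key n; rewrite powRM ?invr_ge0 ?(ltW C0)//.
  rewrite -(mulr_powRB1 (ltW n0) p0) -powR_inv1 ?(ltW C0)// -powRrM mulN1r powRN.
  rewrite mulrC ler_pdivrMr ?powR_gt0// => H.
  rewrite -(ler_pM2l n0); apply: le_trans H _; rewrite le_eqVlt; apply/orP; left; apply/eqP.
  by rewrite /L; ring.
have pm : 0 < p - 1 by rewrite subr_gt0.
pose m := Num.truncn (L `^ (p - 1)^-1).
have : L `^ (p - 1)^-1 < m.+1%:R by apply: truncnS_gt.
move/(gt0_ltr_powR pm); rewrite !nnegrE powR_ge0 => /(_ isT (ler0n _ _)).
rewrite -powRrM mulVf ?gt_eqF// powRr1// => /lt_le_trans /(_ (key2 m)).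
by rewrite ltxx.
Qed.

(** Testing on the indicator of a vertex [y] at distance [n].  The value at [o] does
    not suffice here; but each of the [n] vertices of the path to [y] contributes
    to the norm of the image at least a fixed multiple of the norm of the
    indicator. *)
Lemma necessity_eq1 : p = 1 -> a - 1 < p * (b - 1).
Proof.
move=> pE; rewrite pE mul1r ltNge; apply/negP => cond.
have ba : b <= a by move: cond; lra.
have rb := @rate_gt0 R q q1 b; have qrb := q_rate_lt1 q1 b1; have ra := @rate_gt0 R q q1 a.
have N0 := increment_gt0 q1 rb qrb.
pose c0 : R := q%:R / (2 * @increment_mass R q (rate b)).
have c00 : 0 < c0 by rewrite divr_gt0// mulr_gt0.
have rab : rate a <= rate b.
  by rewrite /rate ler_powR// ?lerN2// ler1n ltnW.
pose f (y x : X) : R[i] := ((x \in [:: y])%:R)%:C.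
have fterm y r s : 0 < r -> (fun x => normc (f y x) `^ r * w s x) =
    fun x => (x \in [:: y])%:R * w s x.
  move=> r0; apply/funext => x; rewrite normc_real normr_nat.
  by case: (x \in _); rewrite ?powR1// powR0 ?gt_eqF.
have fsum y r s : 0 < r -> wLp_powsum o r s (f y) = (w s y)%:E.
  by move=> r0; rewrite powsumE fterm// nsum_seq ?big_seq1// => x; exact: w_ge0.
have fL y r s : 0 < r -> wLp o r s (f y) by move=> r0; rewrite /wLp /= fsum// ltry.
have kf y z : bergman_op o b (f y) z = (K b z y * w b y)%:C.
  have -> : K b z y * w b y = \sum_(x <- [:: y]) K b z x * w b x by rewrite big_seq1.
  rewrite -rsum_seq// -csum_real.
  by congr csum; apply/funext => x; rewrite -rmorphM mulrC.
have key n : c0 * rate a * n%:R <= `|M|.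
  have [y yn] := desc_nonempty n.
  have := powsum_bounded (fL y _ _ p0) (fL y _ _ (ltr0n R 2)).
  rewrite (fsum y p a p0) powsumE [in (`|M| `^ p)]pE powRr1// -EFinM.
  pose F z := normc (bergman_op o b (f y) z) `^ p * w a z.
  pose s := [seq anc j.+1 y | j <- iota 0 n].
  have us : uniq s.
    rewrite map_inj_in_uniq ?iota_uniq// => i j.
    rewrite !mem_iota !add0n => /andP[_ iN] /andP[_ jN].
    by move=> /(congr1 (gdist o)); rewrite !gdist_anc ?yn// => -[].
  have F0 z : 0 <= F z by exact: powterm_ge0.
  have : (nsum (fun z => (z \in s)%:R * F z)%R <= nsum F)%E.
    by apply: le_nsum => z; case: (z \in s); rewrite ?mul1r ?mul0r.
  rewrite nsum_seq// big_map => low up; have := le_trans low up; rewrite lee_fin.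
  rewrite /wt yn; have an : 0 < rate a ^+ n by rewrite exprn_gt0.
  move=> H; rewrite -(ler_pM2r an); apply: le_trans H.
  have -> : c0 * rate a * n%:R * rate a ^+ n = \sum_(i <- iota 0 n) (c0 * rate a ^+ n.+1).
    by rewrite big_const_seq count_predT size_iota iter_addr_0 -mulr_natr exprS; ring.
  rewrite big_seq [leRHS]big_seq; apply: ler_sum => j; rewrite mem_iota add0n => /andP[_ jn].
  have jy : (j < d|y|)%N by rewrite yn.
  rewrite /F kf normc_real pE powRr1// /wt gdist_anc// yn.
  have Kge := kernel_anc_ge q1 rb qrb jy.
  have Kw : c0 * rate b ^+ (n - j) <= `|K b (anc j.+1 y) y * rate b ^+ n|.
    apply: le_trans (ler_norm _).
    have -> : rate b ^+ (n - j) = rate b ^- j * rate b ^+ n.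
      by rewrite -{2}(subnKC (ltnW jn)) exprD mulKf// expf_neq0// gt_eqF.
    by rewrite mulrA; apply: ler_wpM2r => //; rewrite exprn_ge0// ltW.
  have -> : rate a ^+ n.+1 = rate a ^+ (n - j) * rate a ^+ j.+1.
    by rewrite -exprD; congr (_ ^+ _); rewrite addnS subnK// ltnW.
  rewrite mulrA; apply: ler_wpM2r; first by rewrite exprn_ge0// ltW.
  apply: le_trans Kw; apply: ler_wpM2l; first exact: ltW.
  by apply: lerXn2r => //; rewrite nnegrE ltW.
have d0 : 0 < c0 * rate a by rewrite mulr_gt0.
have := key (Num.truncn (`|M| / (c0 * rate a))).+1.
rewrite mulrC -ler_pdivlMr// leNgt truncnS_gt//.
Qed.

End Necessity.

(** * The characterization *)

Section Main.
Context {R : realType} {q : nat} {X : homogeneous_tree q} (o : X).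
Hypothesis q1 : (1 < q)%N.
Variables (p a b : R).
Hypotheses (p1 : 1 <= p) (a1 : 1 < a) (b1 : 1 < b).
Local Notation D := (wLp o p a `&` wLp o 2 b).

Lemma bergman_op_extends_bounded : a - 1 < p * (b - 1) ->
  extends_bounded o p a D (bergman_op o b) (wAp o p a).
Proof.
move=> cond; have [M [_ H]] := bergman_op_bounded o q1 p1 a1 b1 cond.
exists (bergman_op o b); split => //.
- move=> f fs; split; first by have [] := H f fs.
  by apply/(harmonic_flowP o); exact: (bergman_op_harmonic q1 p1 a1 b1 cond).
- by move=> c f g fs gs; apply: (bergman_op_linear q1 p1 a1 b1 cond).
- by exists M => f fs; have [] := H f fs.
Qed.

Lemma extends_bounded_necessary S Y : (forall f, D f -> S f = bergman_op o b f) ->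
  Y `<=` wLp o p a -> extends_bounded o p a D S Y -> a - 1 < p * (b - 1).
Proof.
move=> SE YL [T [TY _ [M TM] TS]].
have bounded f : wLp o p a f -> wLp o 2 b f ->
    wLp o p a (bergman_op o b f) /\ wLp_norm o p a (bergman_op o b f) <= M * wLp_norm o p a f.
  move=> fs f2; have Df : D f by split.
  rewrite -(SE f Df) -(TS f Df); split; last exact: TM.
  by apply: YL; exact: TY.
have [pE|pn1] := eqVneq p 1; first exact: necessity_eq1 bounded pE.
by apply: necessity_gt1 bounded _ => //; rewrite lt_neqAle eq_sym pn1.
Qed.

Lemma extends_bounded_sub (S S' : (X -> R[i]) -> X -> R[i]) (Y Y' : set (X -> R[i])) :
  (forall f, D f -> S f = S' f) -> Y `<=` Y' ->
  extends_bounded o p a D S Y -> extends_bounded o p a D S' Y'.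
Proof.
move=> SS' YY' [T [TY TL TM TS]]; exists T; split => //.
  by move=> f /TY /YY'.
by move=> f Df; rewrite TS// SS'.
Qed.

End Main.

Theorem theorem17 (R : realType) (q : nat) (hq : (2 <= q)%N)
    (X : homogeneous_tree q) (o : X) (p alpha beta : R)
    (hp : 1 <= p) (halpha : 1 < alpha) (hbeta : 1 < beta) :
  (extends_bounded o p alpha (wLp o p alpha `&` wLp o 2 beta)
     (bergman_type_op o alpha beta) (wAp o p alpha)
   <-> alpha - 1 < p * (beta - 1)) /\
  (extends_bounded o p alpha (wLp o p alpha `&` wLp o 2 alpha)
     (bergman_projector o alpha) (wLp o p alpha)
   <-> 1 < p).
Proof.
have opE f : bergman_type_op o alpha beta f = bergman_op o beta f.
  by apply/funext => z; exact: bergman_type_opE.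
have projE f : (wLp o p alpha `&` wLp o 2 alpha) f ->
    bergman_projector o alpha f = bergman_op o alpha f.
  by move=> [_ fs]; exact: bergman_projectorE.
split; split.
- by apply: (extends_bounded_necessary hq hp hbeta) => // f [].
- move=> /(bergman_op_extends_bounded o hq hp halpha hbeta).
  by apply: extends_bounded_sub.
- move=> /(extends_bounded_necessary hq hp halpha projE (@subset_refl _ _)).
  by rewrite ltr_pMl// subr_gt0.
- move=> p1; have cond : alpha - 1 < p * (alpha - 1) by rewrite ltr_pMl// subr_gt0.
  have := bergman_op_extends_bounded o hq hp halpha halpha cond.
  by apply: extends_bounded_sub => [f /projE|f []].
Qed.
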